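(* Let $(A,\mathfrak{m},k)$ be a noetherian local ring and let $M$ be a test module for $A$. Then $A$ is a Gorenstein ring if and only if $M$ has finite Gorenstein dimension, i.e. $\text{G-dim}_A(M)<\infty$.
   Context: All rings are commutative. ''Finite type'' means finitely generated. For a noetherian local ring $A$, a finite type $A$-module $M$ is a test module (for $A$) if for any local homomorphism of noetherian local rings $A\to B$ and any $B$-module of finite type $N$, the condition $\mathrm{Tor}_i^A(M,N)=0$ for all $i\gg 0$ implies that the flat dimension $\mathrm{fd}_A(N)$ of $N$ over $A$ is finite (the zero module is regarded as having finite flat dimension). Let $A$ be a noetherian local ring and $M$ an $A$-module of finite type. One says that $\text{G-dim}_A(M)=0$ if the following three conditions hold: (i) the canonical homomorphism $M\to \mathrm{Hom}_A(\mathrm{Hom}_A(M,A),A)$ is an isomorphism; (ii) $\mathrm{Ext}_A^i(M,A)=0$ for all $i>0$; (iii) $\mathrm{Ext}_A^i(\mathrm{Hom}_A(M,A),A)=0$ for all $i>0$. One says that $\text{G-dim}_A(M)<\infty$ if there exists an exact sequence $0\to T_n\to\cdots\to T_0\to M\to 0$ of finite type $A$-modules with $\text{G-dim}_A(T_i)=0$ for $i=0,\dots,n$. *)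

(* Defs.v *)
(* Commutative and homological algebra over MathComp's [comNzRingType] and
   [lmodType], using the classical axioms of mathcomp-classical. *)
From HB Require Import structures.
From mathcomp Require Import all_boot all_algebra.
From mathcomp Require Import boolp classical_sets functions.
From mathcomp Require Import freeg.

Set Implicit Arguments.
Unset Strict Implicit.
Unset Printing Implicit Defensive.

Import GRing.Theory.
Local Open Scope classical_set_scope.
Local Open Scope quotient_scope.
Local Open Scope ring_scope.

Section Submodules.
Variables (A : comNzRingType) (V : lmodType A).

Definition submodule (S : set V) : Prop :=
  S 0 /\ forall (a : A) (u v : V), S u -> S v -> S (a *: u + v).

Definition lin_span (n : nat) (g : 'I_n -> V) : set V :=
  [set x | exists c : 'I_n -> A, x = \sum_(i < n) c i *: g i].

Definition finite_type : Prop :=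
  exists (n : nat) (g : 'I_n -> V), lin_span g = setT.

End Submodules.
Arguments finite_type {A} V.

Lemma submodule_ker (A : comNzRingType) (U V : lmodType A)
  (h : {linear U -> V}) : submodule [set x | h x = 0].
Proof.
split=> [|a u v hu hv]; rewrite /mkset ?linear0 // linearP.
by rewrite [h u]hu [h v]hv scaler0 addr0.
Qed.

Section LocalRings.

Definition ideal (A : comNzRingType) (I : set A) : Prop :=
  @submodule A A^o I.

Definition noetherian (A : comNzRingType) : Prop :=
  forall I : set A, ideal I ->
    exists (n : nat) (g : 'I_n -> A), I = @lin_span A A^o n g.

Definition maximal_ideal (A : comNzRingType) (I : set A) : Prop :=
  [/\ ideal I, I <> setT &
      forall J : set A, ideal J -> I `<=` J -> J = I \/ J = setT].

Definition local_ring (A : comNzRingType) (m : set A) : Prop :=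
  maximal_ideal m /\ forall m' : set A, maximal_ideal m' -> m' = m.

Definition noetherian_local (A : comNzRingType) (m : set A) : Prop :=
  noetherian A /\ local_ring m.

Definition local_hom (A B : comNzRingType) (mA : set A) (mB : set B)
    (f : {rmorphism A -> B}) : Prop :=
  forall a : A, mA a -> mB (f a).

End LocalRings.

Section RestrictionOfScalars.
Variables (A B : comNzRingType) (f : {rmorphism A -> B}) (N : lmodType B).

Definition restr : Type := let _ := f in N.

HB.instance Definition _ := GRing.Zmodule.on restr.

Definition restr_scale (a : A) (x : restr) : restr := f a *: (x : N).

Lemma restr_scaleA a b x :
  restr_scale a (restr_scale b x) = restr_scale (a * b) x.
Proof. by rewrite /restr_scale scalerA rmorphM. Qed.

Lemma restr_scale1 : left_id 1 restr_scale.
Proof. by move=> x; rewrite /restr_scale rmorph1 scale1r. Qed.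

Lemma restr_scaleDr : right_distributive restr_scale +%R.
Proof. by move=> a x y; exact: (scalerDr (f a) (x : N) (y : N)). Qed.

Lemma restr_scaleDl x : {morph restr_scale^~ x : a b / a + b}.
Proof. by move=> a b; rewrite /restr_scale rmorphD scalerDl. Qed.

HB.instance Definition _ := GRing.Zmodule_isLmodule.Build A restr
  restr_scaleA restr_scale1 restr_scaleDr restr_scaleDl.

End RestrictionOfScalars.

Section QuotientModule.
Variables (A : comNzRingType) (V : lmodType A) (S : set V).

Definition genmod : {pred V} := [pred x | `[< smallest (@submodule A V) S x >]].

Lemma genmod_closed : submod_closed genmod.
Proof.
split=> [|a u v]; first by apply/asboolP => W [[W0 _] _].
move=> /asboolP Su /asboolP Sv; apply/asboolP => W WP.
by case: (WP) => [[_ WD] _]; apply: WD; [apply: Su|apply: Sv].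
Qed.
HB.instance Definition _ := GRing.isSubmodClosed.Build A V genmod genmod_closed.

(* S is any subset of V: the quotient is by the submodule that S generates. *)
Definition quotmod : Type := (Quotient.quot genmod).
HB.instance Definition _ := GRing.Zmodule.on quotmod.

Definition qpi (x : V) : quotmod := \pi_(Quotient.quot genmod) x.
Definition qrepr (x : quotmod) : V := repr (x : (Quotient.quot genmod)).

Lemma qreprK : cancel qrepr qpi.
Proof. by move=> x; exact: reprK. Qed.

Lemma qpi_eq x y : qpi x = qpi y <-> smallest (@submodule A V) S (x - y).
Proof.
split=> [/eqP|xy]; last apply/eqP.
  by rewrite /qpi -Quotient.idealrBE => /asboolP.
by rewrite /qpi -Quotient.idealrBE; apply/asboolP.
Qed.

Lemma qpiD x y : qpi (x + y) = qpi x + qpi y.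
Proof. exact: (raddfD (\pi_(Quotient.quot genmod))). Qed.

Definition qscale (a : A) (x : quotmod) : quotmod := qpi (a *: qrepr x).

Lemma qpi_scale a x : qscale a (qpi x) = qpi (a *: x).
Proof.
apply/qpi_eq; rewrite -scalerBr.
have /qpi_eq H := qreprK (qpi x).
by move=> W WP; case: (WP) => [[W0 WD] _]; rewrite -[_ *: _]addr0; apply: WD => //; apply: H.
Qed.

Lemma qscaleA a b x : qscale a (qscale b x) = qscale (a * b) x.
Proof. by rewrite -[x]qreprK !qpi_scale scalerA. Qed.
Lemma qscale1 : left_id 1 qscale.
Proof. by move=> x; rewrite -[x]qreprK qpi_scale scale1r. Qed.
Lemma qscaleDr : right_distributive qscale +%R.
Proof.
by move=> a x y; rewrite -[x]qreprK -[y]qreprK -qpiD !qpi_scale scalerDr qpiD.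
Qed.
Lemma qscaleDl x : {morph qscale^~ x : a b / a + b}.
Proof. by move=> a b; rewrite -[x]qreprK !qpi_scale scalerDl qpiD. Qed.

HB.instance Definition _ := GRing.Zmodule_isLmodule.Build A quotmod
  qscaleA qscale1 qscaleDr qscaleDl.

Lemma qpi_linear : linear qpi.
Proof. by move=> a x y; rewrite qpiD -qpi_scale. Qed.
HB.instance Definition _ := GRing.isLinear.Build A V quotmod _ qpi qpi_linear.

End QuotientModule.

Section Kernel.
Variables (A : comNzRingType) (V W : lmodType A) (g : {linear V -> W}).

Definition kerp : {pred V} := [pred x | g x == 0].

Lemma kerp_closed : submod_closed kerp.
Proof.
split=> [|a u v]; rewrite !inE ?linear0 //.
by move=> /eqP gu /eqP gv; rewrite linearP gu gv scaler0 addr0.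
Qed.
HB.instance Definition _ := GRing.isSubmodClosed.Build A V kerp kerp_closed.

Record kerm : Type := Kerm { kerv : V; _ : kerv \in kerp }.
HB.instance Definition _ := [isSub for kerv].
HB.instance Definition _ := [Choice of kerm by <:].
HB.instance Definition _ := [SubChoice_isSubLmodule of kerm by <:].

Lemma kerv_linear : linear kerv.
Proof. by move=> a x y; exact: (linearP (val : kerm -> V)). Qed.
HB.instance Definition _ := GRing.isLinear.Build A kerm V _ kerv kerv_linear.

End Kernel.

Definition is_zero (A : comNzRingType) (V : lmodType A) : Prop :=
  forall x : V, x = 0.

Definition exact (A : comNzRingType) (U V W : lmodType A)
    (f : U -> V) (g : V -> W) : Prop :=
  forall y : V, g y = 0 <-> exists x : U, f x = y.

(* ker g / im f; only used with g \o f = 0 *)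
Definition homology (A : comNzRingType) (U V W : lmodType A)
    (f : {linear U -> V}) (g : {linear V -> W}) : lmodType A :=
  @quotmod A (kerm g) [set z | exists u : U, f u = kerv z].

Section HomModule.
Variables (A : comNzRingType) (U V : lmodType A).

Definition linp : {pred U -> V} := [pred f | `[< linear f >]].

Lemma linp_closed : submod_closed linp.
Proof.
split=> [|a f g]; first by apply/asboolP => b x y; rewrite scaler0 addr0.
move=> /asboolP lf /asboolP lg; apply/asboolP => b x y.
rewrite !(addrfctE, scalrfctE) lf lg !scalerDr !scalerA addrACA.
by rewrite [b * a]mulrC.
Qed.
HB.instance Definition _ :=
  GRing.isSubmodClosed.Build A (U -> V) linp linp_closed.

Record hom : Type := Hom { homv : U -> V; _ : homv \in linp }.
HB.instance Definition _ := [isSub for homv].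
HB.instance Definition _ := [Choice of hom by <:].
HB.instance Definition _ := [SubChoice_isSubLmodule of hom by <:].

Lemma homv_linear (f : hom) : linear (homv f).
Proof. by case: f => f /= /asboolP. Qed.
HB.instance Definition _ (f : hom) :=
  GRing.isLinear.Build A U V _ (homv f) (homv_linear f).

Lemma linp_linear (f : {linear U -> V}) : (f : U -> V) \in linp.
Proof. by apply/asboolP; exact: linearP. Qed.
Definition to_hom (f : {linear U -> V}) : hom := Hom (linp_linear f).

End HomModule.

Section HomPrecomposition.
Variables (A : comNzRingType) (U V W : lmodType A) (d : {linear U -> V}).

Definition precomp (f : hom V W) : hom U W := to_hom (homv f \o d).

Lemma precomp_linear : linear precomp.
Proof. by move=> a f g; apply: val_inj. Qed.
HB.instance Definition _ :=
  GRing.isLinear.Build A (hom V W) (hom U W) _ precomp precomp_linear.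

End HomPrecomposition.
Arguments precomp {A U V} W d f.

Section Bidual.
Variables (A : comNzRingType) (M : lmodType A).

Definition dual : lmodType A := hom M A^o.

Definition eval_at (x : M) (f : dual) : A^o := homv f x.

Lemma eval_at_linear x : linear (eval_at x).
Proof. by []. Qed.
HB.instance Definition _ (x : M) :=
  GRing.isLinear.Build A dual A^o _ (eval_at x) (eval_at_linear x).

End Bidual.

Definition biduality (A : comNzRingType) (M : lmodType A) (x : M) :
  dual (dual M) := to_hom (eval_at x).

Section FreeModule.
Variables (A : comNzRingType) (K : choiceType) (M : lmodType A) (f : K -> M).

Lemma fglift_linear : linear (fglift f : {freeg K / A} -> M).
Proof.
have lB (x y : {freeg K / A}) : fglift f (x - y) = fglift f x - fglift f y.
  exact: lift_is_additive.
have l0 : fglift f (0 : {freeg K / A}) = 0 by rewrite -[0 in LHS](subrr 0) lB subrr.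
have lD (x y : {freeg K / A}) : fglift f (x + y) = fglift f x + fglift f y.
  by rewrite -[y in LHS]opprK -[- y]sub0r !lB l0 sub0r opprK.
have lZU a k x : fglift f (a *: << k *g x >>) = a *: fglift f << k *g x >>.
  have -> : a *: << k *g x >> = << (a * k) *g x >> :> {freeg K / A}.
    by apply/eqP/freeg_eqP => z; rewrite coeffZ !coeffU mulrA.
  by rewrite !liftU scalerA.
move=> a x y; rewrite lD; congr (_ + _).
rewrite -[x]freeg_sumE; elim: (dom x) => [|k s IHs].
  by rewrite big_nil scaler0 !l0 scaler0.
by rewrite big_cons scalerDr !lD lZU IHs scalerDr.
Qed.

Definition free_lift (x : {freeg K / A}) : M := fglift f x.
HB.instance Definition _ :=
  GRing.isLinear.Build A {freeg K / A} M _ free_lift fglift_linear.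

End FreeModule.

Section TensorProduct.
Variables (A : comNzRingType) (M N : lmodType A).

Let F : lmodType A := {freeg (M * N)%type / A}.
Let gen (x : M) (y : N) : F := << (x, y) >>.

(* The relations making (x, y) |-> x (x) y bilinear. *)
Definition tensor_rel : set F := [set z |
  (exists a x x' y, z = gen (a *: x + x') y - (a *: gen x y + gen x' y)) \/
  (exists a x y y', z = gen x (a *: y + y') - (a *: gen x y + gen x y'))].

Definition tensor : lmodType A := quotmod tensor_rel.

Definition tens (x : M) (y : N) : tensor := qpi tensor_rel (gen x y).

Lemma tensPl a x x' y : tens (a *: x + x') y = a *: tens x y + tens x' y.
Proof.
rewrite /tens -linearP; apply/qpi_eq; apply: sub_gen_smallest.
by left; exists a, x, x', y.
Qed.

Lemma tensPr a x y y' : tens x (a *: y + y') = a *: tens x y + tens x y'.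
Proof.
rewrite /tens -linearP; apply/qpi_eq; apply: sub_gen_smallest.
by right; exists a, x, y, y'.
Qed.

End TensorProduct.

Section TensorMap.
Variables (A : comNzRingType) (P Q : lmodType A) (d : {linear P -> Q}).
Variable (N : lmodType A).

Let lift : {linear {freeg (P * N)%type / A} -> tensor Q N} :=
  free_lift (fun p : P * N => tens (d p.1) p.2).

Lemma lift_rel z : smallest (@submodule A _) (@tensor_rel A P N) z ->
  lift z = 0.
Proof.
move=> /(_ [set z | lift z = 0]); apply; split; first exact: submodule_ker.
move=> {}z [[a [x [x' [y ->]]]]|[a [x [y [y' ->]]]]];
  rewrite /= linearB linearP /= /free_lift !liftU !scale1r /=.
- by rewrite linearP tensPl subrr.
- by rewrite tensPr subrr.
Qed.

(* The functorial map d (x) N. *)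
Definition tensl (x : tensor P N) : tensor Q N := lift (qrepr x).

Lemma tensl_pi z : tensl (qpi _ z) = lift z.
Proof.
apply/eqP; rewrite -subr_eq0; apply/eqP; rewrite /tensl -linearB.
by apply: lift_rel; apply/qpi_eq; rewrite qreprK.
Qed.

Lemma tenslE x y : tensl (tens x y) = tens (d x) y.
Proof. by rewrite tensl_pi /= /free_lift liftU scale1r. Qed.

Lemma tensl_linear : linear tensl.
Proof.
move=> a x y; rewrite -[x]qreprK -[y]qreprK -linearP !tensl_pi.
exact: linearP.
Qed.
HB.instance Definition _ :=
  GRing.isLinear.Build A (tensor P N) (tensor Q N) _ tensl tensl_linear.

End TensorMap.
Arguments tensl {A P Q} d N x.

(* The canonical surjection onto M from the free module on the elements of M,
   [x] |-> x. *)
Definition free_cover (A : comNzRingType) (M : lmodType A) :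
  {linear {freeg M / A} -> M} := @free_lift A M M id.

(* The canonical free resolution of M: P_i is the free module on the elements
   of the i-th syzygy Z_i, where Z_0 = M and Z_{i+1} = ker (P_i -> Z_i). *)
Section FreeResolution.
Variables (A : comNzRingType) (M : lmodType A).

Fixpoint syzygy (i : nat) : lmodType A :=
  if i is j.+1 then kerm (free_cover (syzygy j)) else M.

Definition free_res (i : nat) : lmodType A := {freeg (syzygy i) / A}.

Definition free_res_d (i : nat) : {linear free_res i.+1 -> free_res i} :=
  @free_lift A (syzygy i.+1) (free_res i) (fun z => kerv z).

Lemma free_cover_surj (V : lmodType A) (x : V) : exists y, free_cover V y = x.
Proof. by exists << x >>; rewrite /= /free_lift liftU scale1r. Qed.

Lemma free_res_dE i x : free_res_d i x = kerv (free_cover (syzygy i.+1) x).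
Proof.
rewrite -[x]freeg_sumE !linear_sum /=.
by apply: eq_bigr => z _; rewrite /free_lift !liftU linearZ.
Qed.

Lemma free_cover_exact i : exact (free_res_d i) (free_cover (syzygy i)).
Proof.
move=> y; split=> [y0|[x <-]]; last first.
  by rewrite free_res_dE; case: (free_cover _ x) => z /= /eqP.
have ky : y \in kerp (free_cover (syzygy i)) by apply/eqP.
have [x xy] := @free_cover_surj (syzygy i.+1) (Kerm ky).
by exists x; rewrite free_res_dE xy.
Qed.

Lemma free_res_exact i : exact (free_res_d i.+1) (free_res_d i).
Proof.
move=> y; rewrite -(free_cover_exact y) free_res_dE.
split=> [yi|->]; last exact: linear0.
by apply: val_inj; rewrite [LHS]yi linear0.
Qed.

End FreeResolution.

(* Tor_i^A(M, N) = H_i(P (x) N) and Ext^i_A(M, N) = H^i(Hom(P, N)) for the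
   canonical free resolution P of M. In degree 0 the missing differential of
   the truncated complex is \0, whose other end is immaterial. *)
Definition Tor (A : comNzRingType) (i : nat) (M N : lmodType A) : lmodType A :=
  match i with
  | 0 => homology (tensl (free_res_d M 0) N)
           (\0 : {linear tensor (free_res M 0) N -> tensor (free_res M 0) N})
  | j.+1 => homology (tensl (free_res_d M j.+1) N) (tensl (free_res_d M j) N)
  end.

Definition Ext (A : comNzRingType) (i : nat) (M N : lmodType A) : lmodType A :=
  match i with
  | 0 => homology (\0 : {linear hom (free_res M 0) N -> hom (free_res M 0) N})
           (precomp N (free_res_d M 0))
  | j.+1 => homology (precomp N (free_res_d M j))
              (precomp N (free_res_d M j.+1))
  end.

Section Modules.
Variable A : comNzRingType.

Definition flat (F : lmodType A) : Prop :=
  forall (U V : lmodType A) (f : {linear U -> V}),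
    injective f -> injective (tensl f F).

Definition injective_module (I : lmodType A) : Prop :=
  forall (U V : lmodType A) (j : {linear U -> V}) (g : {linear U -> I}),
    injective j -> exists h : {linear V -> I}, forall x : U, h (j x) = g x.

Record resolution (M : lmodType A) := Resolution {
  res_obj :> nat -> lmodType A;
  res_d : forall i, {linear res_obj i.+1 -> res_obj i};
  res_aug : {linear res_obj 0 -> M};
  res_aug_surj : forall x : M, exists y, res_aug y = x;
  res_exact0 : exact (res_d 0) res_aug;
  res_exactS : forall i, exact (res_d i.+1) (res_d i)
}.

Record coresolution (M : lmodType A) := Coresolution {
  cores_obj :> nat -> lmodType A;
  cores_d : forall i, {linear cores_obj i -> cores_obj i.+1};
  cores_aug : {linear M -> cores_obj 0};
  cores_aug_inj : injective cores_aug;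
  cores_exact0 : exact cores_aug (cores_d 0);
  cores_exactS : forall i, exact (cores_d i) (cores_d i.+1)
}.

Definition finite_flat_dim (N : lmodType A) : Prop :=
  exists (n : nat) (F : resolution N),
    (forall i, (i <= n)%N -> flat (F i)) /\
    (forall i, (n < i)%N -> is_zero (F i)).

Definition finite_inj_dim (N : lmodType A) : Prop :=
  exists (n : nat) (I : coresolution N),
    (forall i, (i <= n)%N -> injective_module (I i)) /\
    (forall i, (n < i)%N -> is_zero (I i)).

Definition Gdim_eq0 (M : lmodType A) : Prop :=
  [/\ finite_type M,
      bijective (@biduality A M),
      forall i, (0 < i)%N -> is_zero (Ext i M A^o) &
      forall i, (0 < i)%N -> is_zero (Ext i (dual M) A^o)].

Definition finite_Gdim (M : lmodType A) : Prop :=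
  exists (n : nat) (T : resolution M),
    (forall i, (i <= n)%N -> Gdim_eq0 (T i)) /\
    (forall i, (n < i)%N -> is_zero (T i)).

End Modules.

(* Gorenstein local rings: A has finite injective dimension over itself. *)
Definition gorenstein (A : comNzRingType) : Prop :=
  [/\ noetherian A, exists m : set A, local_ring m & finite_inj_dim A^o].

Definition test_module (A : comNzRingType) (mA : set A) (M : lmodType A) :
    Prop :=
  finite_type M /\
  forall (B : comNzRingType) (mB : set B) (f : {rmorphism A -> B}),
    noetherian_local mB -> local_hom mA mB f ->
    forall N : lmodType B, finite_type N ->
      (exists n : nat, forall i, (n <= i)%N -> is_zero (Tor i M (restr f N))) ->
      finite_flat_dim (restr f N).

(* Main.v *)
From HB Require Import structures.
From mathcomp Require Import all_boot all_algebra.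
From mathcomp Require Import boolp classical_sets functions.
From mathcomp Require Import freeg.
Require Import Defs.

(** Write k for the residue field and V^ for the character module Hom(V, Q/Z).

    If A has finite injective dimension n over itself, Ext^i(V, A) vanishes for
    all V and all i > n. A finitely generated X with Ext^i(X, A) = 0 for all
    i > 0 then has Gorenstein dimension zero ([ext_free_Gdim0]): dualizing a
    free cover of X makes the dual of X a syzygy of another dual, so that its
    Ext vanishes as well, and comparing the cover with its bidual makes X reflexive.
    The n-th syzygy of M is such an X, hence M has finite Gorenstein dimension.

    Conversely, let M be a test module of finite Gorenstein dimension; then
    Ext^i(M, A) = 0 for large i ([Gdim_Ext]). Let E be the injective hull of k.
    As E is injective, Tor_i(M, E) is dual to Ext^i(M, A) and vanishes for large
    i ([Ext_ring_dual]). The test property cannot be applied to E, which is not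
    finitely generated in general, but E can be replaced by the Koszul complex
    K(x; E) on generators x of the maximal ideal. Its homology is finitely
    generated, because the complex has the form Hom(G, E) with G a complex of
    finitely generated modules, and because the homology is killed by the
    maximal ideal, while the socle of E is k ([koszul_homology_fg]). Therefore K(x; P), for a free resolution P of E,
    agrees in high degrees with a projective resolution of a finitely generated
    module N ([fg_resolved]).

    Taking a mapping cone of multiplication by x preserves the vanishing of high
    homology of the tensor product with M, so Tor_i(M, N) = 0 for large i, and N
    has finite flat dimension. Hence Tor_i(k, N) = 0 for large i. On k each x
    acts as zero, so the cones split after tensoring with k, and Tor_i(k, E) = 0
    for large i ([hexact_koszul_inv]). This is dual to Ext^i(k, A) = 0 for large
    i ([Ext_dual_ring]). By noetherian induction and Nakayama's lemma, in the same
    range Ext^i(A/J, A) = 0 for every ideal J ([Ext_residue_cyclic]), so A has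
    finite injective dimension by Baer's criterion.

    Tor is handled throughout as Ext with values in a character dual: Tor_i(V, N)
    vanishes when Ext^i(V, N^) does, this Ext is symmetric in V and N
    ([Ext_balance]), and its vanishing is a statement on the extension of maps. *)

Set Implicit Arguments.
Unset Strict Implicit.
Unset Printing Implicit Defensive.

Import GRing.Theory.
Local Open Scope classical_set_scope.
Local Open Scope ring_scope.

(** * Linear maps, submodules and quotients *)

Definition mklin (A : comNzRingType) (U V : lmodType A) (f : U -> V)
    (lf : linear f) : {linear U -> V} :=
  HB.pack f (GRing.isLinear.Build A U V *:%R f lf).

Section LinearMaps.
Variable A : comNzRingType.
Implicit Types U V W X : lmodType A.

Lemma linear_exists U V (f : U -> V) :
  linear f -> exists h : {linear U -> V}, forall x, h x = f x.
Proof. by move=> lf; exists (mklin lf). Qed.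

Lemma add_lin U V (f g : {linear U -> V}) :
  exists h : {linear U -> V}, forall x, h x = f x + g x.
Proof.
by apply: linear_exists => a x y; rewrite !linearP scalerDr addrACA.
Qed.

Lemma sub_lin U V (f g : {linear U -> V}) :
  exists h : {linear U -> V}, forall x, h x = f x - g x.
Proof.
by apply: linear_exists => a x y; rewrite (linearP f) (linearP g) scalerBr opprD addrACA.
Qed.

Lemma scale_lin U V (a : A) (f : {linear U -> V}) :
  exists h : {linear U -> V}, forall x, h x = a *: f x.
Proof.
apply: linear_exists => b x y.
by rewrite linearP scalerDr !scalerA [a * b]mulrC.
Qed.

Lemma comp_lin U V W (g : {linear V -> W}) (f : {linear U -> V}) :
  exists h : {linear U -> W}, forall x, h x = g (f x).
Proof. by apply: linear_exists => a x y; rewrite !linearP. Qed.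

Lemma lin_scale U V (f : {linear U -> V}) a x : f (a *: x) = a *: f x.
Proof. exact: linearZ. Qed.

Definition epi (U V : Type) (p : U -> V) := forall y, exists x, p x = y.

Lemma factor_surj U V W (p : {linear U -> V}) (g : {linear U -> W}) :
  epi p -> (forall u, p u = 0 -> g u = 0) ->
  exists h : {linear V -> W}, forall u, h (p u) = g u.
Proof.
move=> sp kp; pose s v := projT1 (cid (sp v)).
have sE v : p (s v) = v by rewrite /s; case: cid.
have gE u u' : p u = p u' -> g u = g u'.
  by move/eqP; rewrite -subr_eq0 -linearB => /eqP/kp/eqP;
     rewrite linearB subr_eq0 => /eqP.
have lf : linear (fun v => g (s v)).
  by move=> a x y; rewrite -linearP; apply: gE; rewrite linearP !sE.
by exists (mklin lf) => u; apply: gE; rewrite sE.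
Qed.

Lemma corestrict U V X (i : {linear U -> V}) (g : {linear X -> V}) :
  injective i -> (forall x, exists u, i u = g x) ->
  exists h : {linear X -> U}, forall x, i (h x) = g x.
Proof.
move=> ii gi; pose s x := projT1 (cid (gi x)).
have sE x : i (s x) = g x by rewrite /s; case: cid.
have ls : linear s by move=> a x y; apply: ii; rewrite linearP !sE linearP.
by exists (mklin ls).
Qed.

Lemma lin_inj0 U V (i : {linear U -> V}) :
  injective i <-> forall x, i x = 0 -> x = 0.
Proof.
split=> [ii x ix|i0 x y]; first by apply: ii; rewrite ix linear0.
by move/eqP; rewrite -subr_eq0 -linearB => /eqP/i0/eqP; rewrite subr_eq0 => /eqP.
Qed.

Lemma kerv_inj U V (f : {linear U -> V}) : injective (@kerv A U V f).
Proof. by move=> x y; apply: val_inj. Qed.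

Lemma kerv0 U V (f : {linear U -> V}) (z : kerm f) : f (kerv z) = 0.
Proof. by case: z => z /= /eqP. Qed.

Lemma to_kerm U V (f : {linear U -> V}) x : f x = 0 ->
  exists z : kerm f, kerv z = x.
Proof. move=> fx; have kx : x \in kerp f; [exact/eqP | by exists (Kerm kx)]. Qed.

Lemma kerv_exact U V (f : {linear U -> V}) : exact (@kerv A U V f) f.
Proof. by move=> x; split=> [/to_kerm|[z <-]] //; exact: kerv0. Qed.

Lemma submodule_smallest V (S : set V) x :
  submodule S -> smallest (@submodule A V) S x -> S x.
Proof. by move=> sS; apply; split. Qed.

Lemma qpi0 V (S : set V) x : submodule S -> qpi S x = 0 <-> S x.
Proof.
move=> sS; rewrite -[0](linear0 (qpi S)) qpi_eq subr0; split.
  exact: submodule_smallest.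
by move=> Sx W [_]; apply.
Qed.

Lemma qpi_surj V (S : set V) : epi (qpi S).
Proof. by move=> y; exists (qrepr y); exact: qreprK. Qed.

Lemma submoduleD V (S : set V) x y : submodule S -> S x -> S y -> S (x + y).
Proof. by move=> [_ SP] Sx Sy; rewrite -[x]scale1r; apply: SP. Qed.

Lemma submoduleZ V (S : set V) a x : submodule S -> S x -> S (a *: x).
Proof. by move=> [S0 SP] Sx; rewrite -[_ *: x]addr0; apply: SP. Qed.

Lemma submoduleN V (S : set V) x : submodule S -> S x -> S (- x).
Proof. by move=> sS Sx; rewrite -scaleN1r; apply: submoduleZ. Qed.

Lemma submoduleB V (S : set V) x y : submodule S -> S x -> S y -> S (x - y).
Proof. by move=> sS Sx Sy; apply: submoduleD => //; apply: submoduleN. Qed.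

Lemma submodule_range U V (f : {linear U -> V}) :
  submodule [set y | exists x, f x = y].
Proof.
split=> [|a u v [x <-] [y <-]]; first by exists 0; rewrite linear0.
by exists (a *: x + y); rewrite linearP.
Qed.

(** Every submodule is realised as a type, the kernel of its own quotient. *)
Lemma submodule_type V (S : set V) : submodule S ->
  exists (U : lmodType A) (i : {linear U -> V}),
    injective i /\ forall x, S x <-> exists u, i u = x.
Proof.
move=> sS; exists (kerm (qpi S)), (@kerv A _ _ (qpi S)); split.
  exact: kerv_inj.
by move=> x; rewrite -(qpi0 x sS) (kerv_exact _ x).
Qed.

Lemma quotient_exists V (S : set V) : submodule S ->
  exists (W : lmodType A) (p : {linear V -> W}),
    epi p /\ forall x, p x = 0 <-> S x.
Proof.
move=> sS; exists (quotmod S), (qpi S); split; first exact: qpi_surj.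
by move=> x; apply: qpi0.
Qed.

Lemma cokernel U V (f : {linear U -> V}) :
  exists (W : lmodType A) (p : {linear V -> W}), epi p /\ exact f p.
Proof.
by have [W [p [ep pE]]] := quotient_exists (submodule_range f); exists W, p.
Qed.

End LinearMaps.

(** * Injective modules *)

(** Zorn's lemma for nonempty chains only, which is what is needed when the
    empty union is not admissible. *)
Lemma Zorn_set (T : Type) (P : set (set T)) X0 : P X0 ->
  (forall F : set (set T), F !=set0 -> F `<=` P -> total_on F subset ->
     P (\bigcup_(X in F) X)) ->
  exists X, P X /\ forall Y, P Y -> X `<=` Y -> Y = X.
Proof.
move=> PX0 chain; pose P' := [set X | X = set0 \/ P X].
have [F FP totF|X [PX maxX]] := @Zorn_bigcup T P'.
  have [noF|F1] := pselect (forall X, F X -> X = set0).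
    by left; apply: bigcup0.
  have {F1}[X1 [FX1 X1n0]] : exists X, F X /\ X <> set0.
    apply: contrapT => h; apply: F1 => X FX; apply: contrapT => Xn0.
    by apply: h; exists X.
  right; have -> : \bigcup_(X in F) X = \bigcup_(X in F `&` P) X.
    apply/seteqP; split=> x [X FX Xx]; last by exists X => //; case: FX.
    exists X => //; split=> //; case: (FP _ FX) => // X0E.
    by rewrite X0E in Xx.
  apply: chain; [|by move=> X []|by move=> X Y [FX _] [FY _]; apply: totF].
  by exists X1; split=> //; case: (FP _ FX1).
have XP Y : P Y -> X `<=` Y -> Y = X.
  move=> PY XY; apply: contrapT => neXY; apply: (maxX Y); last by right.
  by split=> // YX; apply: neXY; apply/seteqP.
case: PX => [X0E|PX]; last by exists X.
by exists X; split=> //; have := XP X0 PX0; rewrite X0E => <-.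
Qed.

Section Injective.
Variable A : comNzRingType.
Implicit Types U V W X : lmodType A.

(** The form in which injectivity is used: a map g that kills the kernel of f
    descends to the image of f, and extends from there. *)
Lemma inj_factor (I U V : lmodType A) (f : {linear U -> V})
    (g : {linear U -> I}) : injective_module I ->
  (forall u, f u = 0 -> g u = 0) ->
  exists h : {linear V -> I}, forall u, h (f u) = g u.
Proof.
move=> injI fg.
have [X [i [ii iE]]] := submodule_type (submodule_range f).
have [f1 f1E] : exists f1 : {linear U -> X}, forall u, i (f1 u) = f u.
  by apply: corestrict => // u; apply/iE; exists u.
have sf1 : epi f1.
  move=> x; have /iE[u fu] : exists x', i x' = i x by exists x.
  by exists u; apply: ii; rewrite f1E.
have [g1 g1E] : exists g1 : {linear X -> I}, forall u, g1 (f1 u) = g u.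
  apply: factor_surj => // u f1u; apply: fg.
  by rewrite -f1E f1u linear0.
have [h hE] := injI _ _ i g1 ii.
by exists h => u; rewrite -f1E hE g1E.
Qed.

(** Baer's criterion. A maximal partial extension of g, given by its graph, is
    total: what prevents adjoining v to its domain is a map to I defined on the
    ideal of the scalars that bring v into the domain. *)
Lemma baer (I : lmodType A) :
  (forall (J : set A) (g : A -> I), ideal J ->
     (forall a u v, J u -> J v -> g (a * u + v) = a *: g u + g v) ->
     exists q, forall u, J u -> g u = u *: q) ->
  injective_module I.
Proof.
move=> ext U V j g ij.
(* partial extensions of g along j, as graphs *)
pose good (R : set (V * I)%type) :=
  [/\ submodule R, forall y, R (0, y) -> y = 0 & forall u, R (j u, g u)].
pose base := [set x : V * I | exists u, x = (j u, g u)].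
have gbase : good base.
  split; last by move=> u; exists u.
  - split=> [|a _ _ [u ->] [v ->]]; first by exists 0; rewrite !linear0.
    by exists (a *: u + v); rewrite !linearP.
  - by move=> y [u [/esym/eqP + ->]] => /eqP ju; rewrite (_ : u = 0) ?linear0 //;
      apply: ij; rewrite ju linear0.
have [|R [[[R0 RP] R1 Rg] maxR]] := @Zorn_set _ good _ gbase.
  move=> F [X FX] Fgood totF; split.
  - split=> [|a x y [X1 FX1 xX1] [X2 FX2 yX2]].
      by exists X => //; have [[]] := Fgood _ FX.
    have [X12|X21] := totF _ _ FX1 FX2.
      by exists X2 => //; have [[_ +] _ _] := Fgood _ FX2; apply=> //; apply: X12.
    by exists X1 => //; have [[_ +] _ _] := Fgood _ FX1; apply=> //; apply: X21.
  - by move=> y [Y FY Yy]; have [_ + _] := Fgood _ FY; apply.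
  - by move=> u; exists X => //; have [_ _] := Fgood _ FX; apply.
have Rfun v y y' : R (v, y) -> R (v, y') -> y = y'.
  move=> Ry Ry'; apply/eqP; rewrite -subr_eq0; apply/eqP; apply: R1.
  have := RP (-1) _ _ Ry' Ry; congr R; congr pair.
    by rewrite /= scaleN1r addNr.
  by rewrite /= scaleN1r addrC.
have Rtot v : exists y, R (v, y).
  apply: contrapT => nv.
  pose J := [set a | exists y, R (a *: v, y)].
  have iJ : ideal J.
    split=> [|a u w [y Ry] [z Rz]]; first by exists 0; rewrite scale0r.
    exists (a *: y + z); have := RP a _ _ Ry Rz; congr R; congr pair.
    by rewrite /= scalerDl scalerA.
  pose ga a := if pselect (J a) is left Ja then projT1 (cid Ja) else 0.
  have gaE a : J a -> R (a *: v, ga a).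
    by rewrite /ga; case: pselect => // Ja _; case: cid.
  have [|q qE] := ext J ga iJ.
    move=> a u w Ju Jw; apply: (@Rfun ((a * u + w) *: v)).
      by apply: gaE; apply: (iJ.2 a u w).
    have := RP a _ _ (gaE _ Ju) (gaE _ Jw); congr R; congr pair.
    by rewrite /= scalerDl scalerA.
  pose R' := [set x : V * I |
    exists a y, R y /\ x = (y.1 + a *: v, y.2 + a *: q)].
  have RR' : R `<=` R'.
    by move=> [x y] Rxy; exists 0, (x, y); rewrite !scale0r !addr0.
  have R'vq : R' (v, q) by exists 1, 0; rewrite !scale1r !add0r.
  have R'E : R' = R.
    apply: maxR => //; split.
    - split; first by apply: RR'.
      move=> c _ _ [a [y [Ry ->]]] [b [z [Rz ->]]].
      exists (c * a + b), (c *: y + z); split; first exact: RP.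
      congr pair => /=; rewrite scalerDr scalerDl scalerA -!addrA;
        by congr (_ + _); rewrite addrCA.
    - move=> y [a [[w z] /= [Rwz [/eqP w0 ->]]]].
      have avE : a *: v = - w.
        by apply/eqP; rewrite -addr_eq0 addrC eq_sym.
      have Rav : R (a *: v, - z).
        have := RP (-1) _ _ Rwz R0; congr R.
        by rewrite avE addr0; congr pair; rewrite /= scaleN1r.
      have Ja : J a by exists (- z).
      by rewrite -(qE a Ja) (Rfun _ _ _ (gaE _ Ja) Rav) subrr.
    - by move=> u; apply: RR'.
  by apply: nv; exists q; rewrite -R'E.
pose h v := projT1 (cid (Rtot v)).
have hE v : R (v, h v) by rewrite /h; case: cid.
have lh : linear h.
  move=> a x y; apply: (@Rfun (a *: x + y)); first exact: hE.
  exact: (RP a _ _ (hE x) (hE y)).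
by exists (mklin lh) => u; apply: (@Rfun (j u)).
Qed.

Lemma inj_funs (T : Type) (I : lmodType A) :
  injective_module I -> injective_module (T -> I : lmodType A).
Proof.
move=> injI U V j g ij.
have gt t : exists h : {linear V -> I}, forall u, h (j u) = g u t.
  have lg : linear (fun u => g u t) by move=> a x y; rewrite linearP.
  exact: (injI _ _ j (mklin lg)).
pose h v t := projT1 (cid (gt t)) v.
have lh : linear h.
  by move=> a x y; apply/funext => t; rewrite /h linearP.
by exists (mklin lh) => u; apply: funext => t; rewrite /= /h; case: cid.
Qed.

End Injective.

(** * Additive characters *)

Section QZ.

Let M : lmodType int := zmodule rat.
Definition QZ : lmodType int := quotmod [set x : M | exists n : int, n%:~R = x].

Lemma submodule_ints : submodule [set x : M | exists n : int, n%:~R = x].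
Proof.
split=> [|a _ _ [x <-] [y <-]]; first by exists 0.
by exists (a * x + y); rewrite intrD intrM scalezrE mulrzl.
Qed.

Lemma ideal_int (J : set int) : ideal J ->
  exists2 d, J d & forall x, J x -> exists b, x = b * d.
Proof.
move=> iJ; have [J0 JP] := iJ.
have [allJ0|] := pselect (forall x, J x -> x = 0).
  by exists 0 => // x /allJ0 ->; exists 0; rewrite mul0r.
move=> nJ; have {nJ}[n [n0 Jn]] : exists n : nat, (0 < n)%N /\ J n.
  apply: contrapT => h; apply: nJ => x Jx; apply: contrapT => x0; apply: h.
  exists `|x|%N; split; first by rewrite absz_gt0; apply/eqP.
  by rewrite abszE; case: (Num.Theory.ger0P x) => // _;
     apply: (@submoduleN int int^o J).
have exn : exists n : nat, `[< (0 < n)%N /\ J n >] by exists n; apply/asboolP.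
case: (ex_minnP exn) => d /asboolP[d0 Jd] mind; exists d%:Z => // x Jx.
exists (x %/ d)%Z; rewrite {1}(divz_eq x d).
have Jr : J (x %% d)%Z.
  have -> : (x %% d)%Z = - (x %/ d)%Z * d + x.
    by rewrite {3}(divz_eq x d) mulNr addKr.
  exact: JP.
suff -> : (x %% d)%Z = 0 by rewrite addr0.
have dn0 : (d : int) != 0 by rewrite -lt0n.
have := modz_ge0 x dn0; have := ltz_mod x dn0.
case: (x %% d)%Z Jr => // r Jr rd _.
case: r Jr rd => // r Jr; rewrite ltz_nat absz_nat => rd.
have /mind : `[< (0 < r.+1)%N /\ J r.+1 >] by apply/asboolP.
by rewrite leqNgt rd.
Qed.

Lemma QZ_injective : injective_module QZ.
Proof.
apply: baer => J g iJ gP.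
have [d Jd dE] := ideal_int iJ.
have [r rE] := @qpi_surj _ _ _ (g d).
have J0 : J 0 by case: iJ.
have g0 : g 0 = 0.
  by have := gP (-1) _ _ J0 J0; rewrite mulr0 addr0 scaleN1r addNr.
have gM b : g (b * d) = b *: g d.
  by have := gP b d 0 Jd J0; rewrite addr0 g0 addr0.
have [d0|dn0] := eqVneq d 0.
  by exists 0 => u /dE[b ->]; rewrite d0 mulr0 g0 scale0r.
exists (qpi _ ((r : rat) / d%:~R : M)) => u /dE[b ->].
rewrite gM -scalerA -rE; congr (b *: _).
rewrite -lin_scale; congr qpi.
by rewrite scalezrE -mulrzl mulrC divfK // intr_eq0.
Qed.

Lemma QZ_order (d n : int) : d != 0 ->
  n *: (qpi _ (d%:~R^-1 : M) : QZ) = 0 <-> exists b, n = b * d.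
Proof.
move=> d0; rewrite -lin_scale (qpi0 _ submodule_ints) scalezrE /=.
have d0' : d%:~R != 0 :> rat by rewrite intr_eq0.
split=> [[b bE]|[b ->]]; exists b.
  apply/eqP; rewrite -(eqr_int rat) intrM bE.
  by rewrite -[_^-1 *~ n]mulrzl divfK.
by rewrite -[_^-1 *~ (b * d)]mulrzl intrM mulfK.
Qed.

End QZ.

Section Characters.
Variable A : comNzRingType.

Definition mul_lin (a : A) (x : zmodule A) : zmodule A := a * (x : A).

Lemma mul_lin_linear a : linear (mul_lin a).
Proof. by move=> n x y; rewrite /mul_lin mulrDr !scalezrE mulrzAr. Qed.

(** Hom(A, Q/Z), the injective cogenerator from which all injective modules
    below are made. *)
Definition chars : Type := hom (zmodule A) QZ.
HB.instance Definition _ := GRing.Zmodule.on chars.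

Definition chars_scale (a : A) (h : chars) : chars :=
  precomp QZ (mklin (mul_lin_linear a)) h.

Lemma charsP (g h : chars) : (forall x, homv g x = homv h x) -> g = h.
Proof. by move=> gh; apply: val_inj; apply: funext. Qed.

Lemma chars_scaleA a b h :
  chars_scale a (chars_scale b h) = chars_scale (a * b) h.
Proof.
by apply: charsP => x; rewrite /= /mul_lin mulrA [b * a]mulrC.
Qed.
Lemma chars_scale1 : left_id 1 chars_scale.
Proof. by move=> h; apply: charsP => x; rewrite /= /mul_lin mul1r. Qed.
Lemma chars_scaleDr : right_distributive chars_scale +%R.
Proof. by move=> a g h; apply: charsP. Qed.
Lemma chars_scaleDl h : {morph chars_scale^~ h : a b / a + b}.
Proof.
move=> a b; apply: charsP => x; rewrite /= /mul_lin mulrDl.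
exact: (raddfD (homv h)).
Qed.

HB.instance Definition _ := GRing.Zmodule_isLmodule.Build A chars
  chars_scaleA chars_scale1 chars_scaleDr chars_scaleDl.

Definition chi_at (h : chars) (a : A) : QZ := homv h a.

Lemma chi_atZ a h b : chi_at (a *: h) b = chi_at h (a * b).
Proof. by []. Qed.
Lemma chi_atP a g h b : chi_at (a *: g + h) b = chi_at g (a * b) + chi_at h b.
Proof. by []. Qed.

Lemma additive_linear (U V : lmodType int) (f : U -> V) :
  (forall x y, f (x + y) = f x + f y) -> linear f.
Proof.
move=> fD n x y; rewrite fD; congr (_ + _).
have f0 : f 0 = 0 by apply: (addrI (f 0)); rewrite -fD !addr0.
have fB : zmod_morphism f.
  move=> u v; apply: (addIr (f v)).
  by rewrite -fD !subrK.
pose fa : {additive U -> V} :=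
  HB.pack f (GRing.isZmodMorphism.Build U V f fB).
by rewrite -[n]intz !scaler_int; exact: (raddfMz fa).
Qed.

Lemma chars_intro (h : A -> QZ) : (forall x y, h (x + y) = h x + h y) ->
  exists c : chars, forall a, chi_at c a = h a.
Proof.
move=> hD; have lh : linear (h : zmodule A -> QZ) by apply: additive_linear.
by exists (to_hom (mklin lh)).
Qed.

Lemma chars_lin (V : lmodType A) (h : {linear zmodule V -> QZ}) :
  exists g : {linear V -> chars}, forall v a, chi_at (g v) a = h (a *: v).
Proof.
have hv v : exists c : chars, forall a, chi_at c a = h (a *: v).
  by apply: chars_intro => x y; rewrite scalerDl (raddfD h).
pose g v := projT1 (cid (hv v)).
have gE v a : chi_at (g v) a = h (a *: v) by rewrite /g; case: cid.
have lg : linear g.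
  move=> a x y; apply: charsP => b.
  rewrite [LHS]gE [RHS]chi_atP !gE scalerDr (raddfD h) scalerA [b * a]mulrC.
  by [].
by exists (mklin lg).
Qed.

Lemma zlin (V W : lmodType A) (f : {linear V -> W}) :
  exists h : {linear zmodule V -> zmodule W}, forall v, h v = f v.
Proof.
have lf : linear (f : zmodule V -> zmodule W).
  by apply: additive_linear => x y; exact: (raddfD f).
by exists (mklin lf).
Qed.

(** A linear map from V to the characters of A is the same as an additive map
    from V to Q/Z, obtained by evaluating at 1. *)
Lemma chars_injective : injective_module (chars : lmodType A).
Proof.
move=> U V j g ij.
have [jz jzE] := zlin j.
have lg : linear ((fun u => chi_at (g u) 1) : zmodule U -> QZ).
  by apply: additive_linear => x y; rewrite (raddfD g).
have ijz : injective jz by move=> x y; rewrite !jzE => /ij.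
have [h hE] := QZ_injective (mklin lg) ijz.
have [k kE] := chars_lin h; exists k => u; apply: charsP => a.
rewrite [LHS]kE -lin_scale -jzE hE /= lin_scale.
by rewrite chi_atZ mulr1.
Qed.

(** Separating a nonzero element from zero by an additive map to the circle of
    rationals: send it to an element of the same order, or to an element of
    order 2 when its order is infinite. *)
Lemma chars_cogenerator (V : lmodType A) (v : V) : v != 0 ->
  exists g : {linear V -> chars}, g v != 0.
Proof.
move=> v0.
have lf : linear ((fun n => v *~ n) : int^o -> zmodule V).
  by apply: additive_linear => x y; rewrite mulrzDr.
have iJ : @ideal int [set n : int | v *~ n = 0].
  by apply: (@submodule_ker int int^o (zmodule V) (mklin lf)).
have [d Jd dE] := ideal_int iJ.
have [q [qn0 qE]] : exists q : QZ, q != 0 /\ forall n : int, v *~ n = 0 -> n *: q = 0.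
  have [d0|dn0] := eqVneq d 0.
    exists (qpi _ (((2 : int)%:~R : rat)^-1 : zmodule rat)); split.
      apply/eqP => /eqP; rewrite -[X in X == 0]scale1r => /eqP/QZ_order[] // b.
      by case: b => // -[|[]].
    by move=> n /dE[b ->]; rewrite d0 mulr0 scale0r.
  exists (qpi _ ((d%:~R : rat)^-1 : zmodule rat)); split.
    apply/eqP => /eqP; rewrite -[X in X == 0]scale1r => /eqP.
    move=> /(QZ_order _ dn0)[b bE].
    move/eqP: v0; apply; rewrite -[v]mulr1z bE mulrC mulrzA.
    by rewrite [v *~ d]Jd mul0rz.
  by move=> n /dE[b ->]; apply/QZ_order => //; exists b.
have lg : linear ((fun n => n *: q) : int^o -> QZ).
  by move=> n x y; rewrite scalerDl scalerA.
have [h hE] := inj_factor (f := mklin lf) (g := mklin lg) QZ_injective qE.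
have [g gE] := chars_lin h; exists g; apply: contra_neq qn0 => gv.
have := hE 1; rewrite /= mulr1z scale1r -[v in h v]scale1r -gE gv => <-.
by [].
Qed.

End Characters.

(** * Vanishing of Ext *)

Section Ext.
Variable A : comNzRingType.
Implicit Types U V W P Q X Y Z J I E F L M N : lmodType A.

Definition ses U V W (i : {linear U -> V}) (p : {linear V -> W}) : Prop :=
  [/\ injective i, epi p & exact i p].

Definition projective P : Prop :=
  forall U V (p : {linear U -> V}) (g : {linear P -> V}), epi p ->
    exists h : {linear P -> U}, forall x, p (h x) = g x.

Section Sequences.
Variables (U V W : lmodType A) (i : {linear U -> V}) (p : {linear V -> W}).
Hypothesis ip : ses i p.

Lemma ses_comp0 u : p (i u) = 0.
Proof. by case: ip => _ _ e; apply/e; exists u. Qed.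

Lemma ses_into (X : lmodType A) (f : {linear X -> V}) : (forall x, p (f x) = 0) ->
  exists g : {linear X -> U}, forall x, i (g x) = f x.
Proof.
by case: ip => ii _ e pf; apply: corestrict => // x; apply/e/pf.
Qed.

Lemma ses_out (X : lmodType A) (f : {linear V -> X}) : (forall u, f (i u) = 0) ->
  exists g : {linear W -> X}, forall v, g (p v) = f v.
Proof.
case: ip => _ pe e fi; apply: factor_surj => // v /e[u <-]; exact: fi.
Qed.

End Sequences.

(** The dual that turns Tor into Ext: Ext^i(V, cdual N) is the module of
    characters of Tor_i(V, N). *)
Definition cdual V : lmodType A := hom V (chars A).

Lemma lin_hom U V (h : hom U V) a x y :
  homv h (a *: x + y) = a *: homv h x + homv h y.
Proof. exact: linearP. Qed.

Lemma homP U V (g h : hom U V) : (forall x, homv g x = homv h x) -> g = h.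
Proof. by move=> gh; apply: val_inj; apply: funext. Qed.

(** W embeds by evaluation, since the characters separate its elements. *)
Definition inj_env W : lmodType A := cdual W -> chars A.

Lemma env_in_linear W : linear (fun (w : W) (h : cdual W) => homv h w).
Proof. by move=> a x y; apply: funext => h; rewrite lin_hom. Qed.
Definition env_in W : {linear W -> inj_env W} := mklin (@env_in_linear W).

Lemma inj_env_injective W : injective_module (inj_env W).
Proof. exact/inj_funs/chars_injective. Qed.

Lemma env_in_inj W : injective (env_in W).
Proof.
apply/lin_inj0 => w w0; apply: contrapT => /eqP/chars_cogenerator[g /eqP].
by apply; have /= := congr1 (fun f => f (to_hom g)) w0.
Qed.

Definition cosyz W : lmodType A := quotmod [set y | exists w, env_in W w = y].
Definition env_out W : {linear inj_env W -> cosyz W} := qpi _.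

Lemma env_ses W : ses (env_in W) (env_out W).
Proof.
split; [exact: env_in_inj|exact: qpi_surj|].
by move=> y; rewrite (qpi0 _ (submodule_range (env_in W))).
Qed.

(** Ext^1(V, W) = x Ext^1(V, W), with Ext^1(V, W) computed as the cokernel of
    Hom(V, J) -> Hom(V, J / W) for J = inj_env W. For x = 0 this is the vanishing
    of Ext^1, and for x in the maximal ideal it is the hypothesis of Nakayama's
    lemma for Ext^1. *)
Definition xext (x : A) V W : Prop := forall f : {linear V -> cosyz W},
  exists (f' : {linear V -> cosyz W}) (g : {linear V -> inj_env W}),
  forall v, f v = x *: f' v + env_out W (g v).

(** The same condition for Ext^1 computed from any J -> W' with kernel W, and
    below it as the cokernel of Hom(P, W) -> Hom(U, W). *)
Definition cokerJ (x : A) V (J W : lmodType A) (p : {linear J -> W}) : Prop :=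
  forall f : {linear V -> W},
  exists (f' : {linear V -> W}) (g : {linear V -> J}),
  forall v, f v = x *: f' v + p (g v).

Definition cokerP (x : A) U P W (i : {linear U -> P}) : Prop :=
  forall f : {linear U -> W},
  exists (f' : {linear U -> W}) (g : {linear P -> W}),
  forall u, f u = x *: f' u + g (i u).

Section Balance.
Variables (x : A) (U P V W J W' : lmodType A).
Variables (q : {linear U -> P}) (p : {linear P -> V}).
Variables (i : {linear W -> J}) (r : {linear J -> W'}).
Hypotheses (qp : ses q p) (ir : ses i r) (injJ : injective_module J).

(** The two ways of computing Ext^1 agree: a map V -> W' lifts along P -> V to
    P -> J, whose restriction to U takes values in W, and conversely. *)
Lemma cokerJ_P : projective P -> cokerJ x V r -> cokerP x W q.
Proof.
move=> prP HJ f; have [iq ep qpe] := qp; have [ii er ire] := ir.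
have [iof iofE] := comp_lin i f; have [h hE] := @injJ _ _ q iof iq.
have [rh rhE] := comp_lin r h.
have [k kE] : exists k : {linear V -> W'}, forall y, k (p y) = rh y.
  by apply: (ses_out qp) => u; rewrite rhE hE iofE (ses_comp0 ir).
have [k' [g kE']] := HJ k; have [k'p k'pE] := comp_lin k' p.
have [h' hE'] := prP _ _ r k'p er; have [h'q h'qE] := comp_lin h' q.
have [f' fE'] : exists f' : {linear U -> W}, forall u, i (f' u) = h'q u.
  by apply: (ses_into ir) => u; rewrite h'qE hE' k'pE (ses_comp0 qp) linear0.
have [xh' xhE'] := scale_lin x h'; have [h2 h2E] := sub_lin h xh'.
have [gp gpE] := comp_lin g p; have [h3 h3E] := sub_lin h2 gp.
have [g' gE'] : exists g' : {linear P -> W}, forall y, i (g' y) = h3 y.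
  apply: (ses_into ir) => y.
  rewrite h3E h2E xhE' gpE !linearB (lin_scale r) hE' k'pE -rhE -kE kE'.
  by rewrite -addrA -opprD subrr.
exists f', g' => u; apply: ii; rewrite linearD (lin_scale i) fE' gE' h3E h2E.
rewrite xhE' gpE h'qE hE iofE (ses_comp0 qp) linear0 subr0.
by rewrite addrC subrK.
Qed.

Lemma cokerP_J : projective P -> cokerP x W q -> cokerJ x V r.
Proof.
move=> prP HP f; have [iq ep qpe] := qp; have [ii er ire] := ir.
have [fp fpE] := comp_lin f p; have [h hE] := prP _ _ r fp er.
have [hq hqE] := comp_lin h q.
have [k kE] : exists k : {linear U -> W}, forall u, i (k u) = hq u.
  by apply: (ses_into ir) => u; rewrite hqE hE fpE (ses_comp0 qp) linear0.
have [k' [g kE']] := HP k; have [ik' ik'E] := comp_lin i k'.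
have [h' hE'] := @injJ _ _ q ik' iq; have [rh' rhE'] := comp_lin r h'.
have [f' fE'] : exists f' : {linear V -> W'}, forall y, f' (p y) = rh' y.
  by apply: (ses_out qp) => u; rewrite rhE' hE' ik'E (ses_comp0 ir).
have [xh' xhE'] := scale_lin x h'; have [h2 h2E] := sub_lin h xh'.
have [ig igE] := comp_lin i g; have [h3 h3E] := sub_lin h2 ig.
have [g' gE'] : exists g' : {linear V -> J}, forall y, g' (p y) = h3 y.
  apply: (ses_out qp) => u.
  rewrite h3E h2E xhE' igE hE' ik'E -hqE -kE kE' linearD (lin_scale i).
  by rewrite -addrA -opprD subrr.
exists f', g' => v; have [y <-] := ep v.
rewrite fE' gE' h3E h2E xhE' igE rhE' !linearB (lin_scale r) hE fpE.
by rewrite (ses_comp0 ir) subr0 addrC subrK.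
Qed.

(** With no multiple of x to be lifted along P -> V, the same argument applies to
    every short exact sequence. *)
Lemma cokerJ_extend : cokerJ 0 V r -> forall f : {linear U -> W},
  exists g : {linear P -> W}, forall u, g (q u) = f u.
Proof.
move=> HJ f; have [iq ep qpe] := qp; have [ii er ire] := ir.
have [iof iofE] := comp_lin i f; have [h hE] := @injJ _ _ q iof iq.
have [rh rhE] := comp_lin r h.
have [k kE] : exists k : {linear V -> W'}, forall y, k (p y) = rh y.
  by apply: (ses_out qp) => u; rewrite rhE hE iofE (ses_comp0 ir).
have [k' [g kE']] := HJ k.
have [gp gpE] := comp_lin g p; have [h3 h3E] := sub_lin h gp.
have [g' gE'] : exists g' : {linear P -> W}, forall y, i (g' y) = h3 y.
  apply: (ses_into ir) => y.
  by rewrite h3E gpE linearB -rhE -kE kE' scale0r add0r subrr.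
exists g' => u; apply: ii.
by rewrite gE' h3E gpE (ses_comp0 qp) linear0 subr0 hE iofE.
Qed.

End Balance.

(** * Projective modules *)

Lemma freeg_gen (K : choiceType) (S : {freeg K / A} -> Prop) :
  S 0 -> (forall a k y, S y -> S (a *: << k >> + y)) -> forall x, S x.
Proof.
move=> S0 SD x; rewrite -[x]freeg_sumE; elim: (dom x) => [|k s IHs].
  by rewrite big_nil.
rewrite big_cons.
have -> : << coeff k x *g k >> = coeff k x *: << k >> :> {freeg K / A}.
  by apply/eqP/freeg_eqP => z; rewrite coeffZ !coeffU mul1r.
exact: SD.
Qed.

Lemma free_projective (K : choiceType) : projective {freeg K / A}.
Proof.
move=> U V p g ep.
have hk k : exists u, p u = g << k >> by apply: ep.
pose f k := projT1 (cid (hk k)).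
have fE k : p (f k) = g << k >> by rewrite /f; case: cid.
exists (free_lift f); elim/freeg_gen => [|a k y IH]; first by rewrite !linear0.
rewrite !linearP IH; congr (_ *: _ + _).
by rewrite -fE /= /free_lift liftU scale1r.
Qed.

Lemma syzygy_ses V i : ses (@kerv A _ _ (free_cover (syzygy V i)) : 
   {linear syzygy V i.+1 -> free_res V i}) (free_cover (syzygy V i)).
Proof. by split; [exact: kerv_inj|exact: free_cover_surj|exact: kerv_exact]. Qed.

Lemma prod_projective P Q :
  projective P -> projective Q -> projective (P * Q)%type.
Proof.
move=> prP prQ U V p g ep.
have l1 : linear (fun x : P => (x, 0) : P * Q).
  by move=> a x y; congr pair; rewrite /= scaler0 addr0.
have l2 : linear (fun x : Q => (0, x) : P * Q).
  by move=> a x y; congr pair; rewrite /= scaler0 addr0.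
have [g1 g1E] := comp_lin g (mklin l1); have [g2 g2E] := comp_lin g (mklin l2).
have [h1 h1E] := prP _ _ p g1 ep; have [h2 h2E] := prQ _ _ p g2 ep.
have lh : linear (fun x : P * Q => h1 x.1 + h2 x.2).
  by move=> a x y; rewrite !linearP /= scalerDr addrACA.
exists (mklin lh) => -[x y] /=; rewrite linearD h1E h2E g1E g2E /= -linearD.
by congr (g _); congr pair; rewrite /= ?addr0 ?add0r.
Qed.

(** The kernel of an epimorphism onto a projective is a direct summand. *)
Lemma kernel_projective U P Q (i : {linear U -> P}) (p : {linear P -> Q}) :
  ses i p -> projective P -> projective Q -> projective U.
Proof.
move=> ip prP prQ X Y f g ef; have [ii ep ipe] := ip.
have [s sE] := prQ _ _ p (mklin (linearP (idfun : {linear Q -> Q}))) ep.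
have [sp spE] := comp_lin s p.
have [h hE] := sub_lin (mklin (linearP (idfun : {linear P -> P}))) sp.
have [t tE] : exists t : {linear P -> U}, forall x, i (t x) = h x.
  by apply: (ses_into ip) => x; rewrite hE spE linearB sE /= subrr.
have tK u : t (i u) = u.
  by apply: ii; rewrite tE hE spE (ses_comp0 ip) linear0 subr0.
have [gt gtE] := comp_lin g t; have [k kE] := prP _ _ f gt ef.
have [ki kiE] := comp_lin k i; exists ki => u.
by rewrite kiE kE gtE tK.
Qed.

Lemma zero_projective Q : is_zero Q -> projective Q.
Proof.
by move=> Q0 U V p g _; exists (\0 : {linear Q -> U}) => x; rewrite (Q0 x) !linear0.
Qed.

Lemma enough_proj V : exists U P (i : {linear U -> P}) (p : {linear P -> V}),
  ses i p /\ projective P.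
Proof.
exists (syzygy V 1), (free_res V 0), (@kerv A _ _ (free_cover V)), (free_cover V).
by split; [exact: (syzygy_ses V 0)|exact: free_projective].
Qed.

(** * Higher Ext *)

Lemma xextP (x : A) U P V W (q : {linear U -> P}) (p : {linear P -> V}) :
  ses q p -> projective P -> xext x V W <-> cokerP x W q.
Proof.
move=> qp prP; have iJ := @inj_env_injective W; have es := env_ses W.
by split; [apply: (cokerJ_P qp es)|apply: (cokerP_J qp es)].
Qed.

Lemma xextJ (x : A) V W J W' (i : {linear W -> J}) (r : {linear J -> W'}) :
  ses i r -> injective_module J -> xext x V W <-> cokerJ x V r.
Proof.
move=> ir injJ; have [U [P [q [p [qp prP]]]]] := enough_proj V.
rewrite (xextP _ _ qp prP).
by split; [apply: (cokerP_J qp ir)|apply: (cokerJ_P qp ir)].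
Qed.

(** Dimension shifting: both sides say that maps from the syzygy U to the
    cosyzygy W' are combinations of x-multiples and restrictions along
    U -> P -> J -> W'. *)
Lemma xext_shift (x : A) U P V W J W'
    (q : {linear U -> P}) (p : {linear P -> V})
    (i : {linear W -> J}) (r : {linear J -> W'}) :
  ses q p -> projective P -> ses i r -> injective_module J ->
  xext x U W <-> xext x V W'.
Proof.
move=> qp prP ir injJ; rewrite (xextP _ _ qp prP) (xextJ _ _ ir injJ).
have [iq ep qpe] := qp; have [ii er ire] := ir.
split=> H f; have [f' [g fE]] := H f.
  have [h hE] := injJ _ _ q g iq; have [rh rhE] := comp_lin r h.
  by exists f', rh => u; rewrite fE rhE hE.
have [h hE] := prP _ _ r g er; have [hq hqE] := comp_lin h q.
by exists f', hq => u; rewrite fE hqE hE.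
Qed.

Fixpoint cosyzygy W (i : nat) : lmodType A :=
  if i is j.+1 then cosyz (cosyzygy W j) else W.

(** Conditions on Ext in degree i + 1, as conditions in degree 1 on a cosyzygy:
    Ext^{i+1}(V, W) is equal to x Ext^{i+1}(V, W), respectively zero. *)
Definition xExt (x : A) (i : nat) V W : Prop := xext x V (cosyzygy W i).
Definition ExtV (i : nat) V W : Prop := xExt 0 i V W.

Lemma xExt_syz (x : A) i U P V W (q : {linear U -> P}) (p : {linear P -> V}) :
  ses q p -> projective P -> xExt x i.+1 V W <-> xExt x i U W.
Proof.
move=> qp prP; rewrite /xExt /=.
by rewrite -(xext_shift _ qp prP (env_ses _) (@inj_env_injective _)).
Qed.

End Ext.

Section ExtTheory.
Variable A : comNzRingType.
Implicit Types U V W P Q X Y Z J I E F L M N R : lmodType A.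

Lemma xExt_syzygy (x : A) i V W :
  xExt x i V W <-> xext x (syzygy V i) W.
Proof.
suff H k : xExt x i (syzygy V k) W <-> xext x (syzygy V (i + k)) W.
  by have := H 0; rewrite addn0.
elim: i k => [|i IHi] k //.
rewrite (xExt_syz _ _ _ (syzygy_ses V k) (@free_projective _ _)).
by rewrite addSnnS -IHi.
Qed.

Lemma Ext_shiftJ i V W J W' (j : {linear W -> J}) (r : {linear J -> W'}) :
  ses j r -> injective_module J -> ExtV i.+1 V W <-> ExtV i V W'.
Proof.
move=> jr injJ; rewrite /ExtV !xExt_syzygy.
exact: (xext_shift _ (syzygy_ses V i) (@free_projective _ _) jr injJ).
Qed.

Lemma Ext_shiftP i U P V W (q : {linear U -> P}) (p : {linear P -> V}) :
  ses q p -> projective P -> ExtV i.+1 V W <-> ExtV i U W.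
Proof. exact: xExt_syz. Qed.

Lemma Ext1_lift V W J W' (j : {linear W -> J}) (r : {linear J -> W'}) :
  ses j r -> injective_module J ->
  ExtV 0 V W <-> forall f : {linear V -> W'},
    exists g : {linear V -> J}, forall v, r (g v) = f v.
Proof.
move=> jr injJ; rewrite /ExtV /xExt (xextJ _ _ jr injJ).
split=> H f; first by have [f' [g fE]] := H f; exists g => v;
  rewrite fE scale0r add0r.
by have [g gE] := H f; exists f, g => v; rewrite scale0r add0r.
Qed.

Lemma Ext1_extend U P V W (q : {linear U -> P}) (p : {linear P -> V}) :
  ses q p -> ExtV 0 V W -> forall f : {linear U -> W},
  exists g : {linear P -> W}, forall u, g (q u) = f u.
Proof. by move=> qp; apply: (cokerJ_extend qp (env_ses W)); exact: inj_env_injective. Qed.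

Lemma Ext1P U P V W (q : {linear U -> P}) (p : {linear P -> V}) :
  ses q p -> projective P ->
  ExtV 0 V W <-> forall f : {linear U -> W},
    exists g : {linear P -> W}, forall u, g (q u) = f u.
Proof.
move=> qp prP; split; first by move=> H f; apply: (Ext1_extend qp H).
move=> H; rewrite /ExtV /xExt (xextP _ _ qp prP) => f.
by have [g gE] := H f; exists f, g => u; rewrite scale0r add0r.
Qed.

(** Maps out of the syzygy are maps out of Q that kill the image of R. *)
Lemma Ext1_presentation R Q P V W (r : {linear R -> Q}) (q : {linear Q -> P})
    (p : {linear P -> V}) :
  epi p -> exact q p -> exact r q -> projective P ->
  ExtV 0 V W <-> forall f : {linear Q -> W}, (forall z, f (r z) = 0) ->
    exists g : {linear P -> W}, forall u, g (q u) = f u.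
Proof.
move=> ep qpe rqe prP.
have ks : ses (@kerv A _ _ p) p by split; [exact: kerv_inj|by []|exact: kerv_exact].
have [q' q'E] : exists q' : {linear Q -> kerm p}, forall x, kerv (q' x) = q x.
  by apply: corestrict => [|x]; [exact: kerv_inj|apply/kerv_exact/qpe; exists x].
have eq' : epi q'.
  move=> y; have /qpe[x xE] := kerv0 y.
  by exists x; apply: kerv_inj; rewrite q'E.
rewrite (Ext1P _ ks prP); split=> H f.
  move=> fr; have [f' f'E] : exists f' : {linear kerm p -> W}, forall x, f' (q' x) = f x.
    apply: factor_surj => // u u0; have /rqe[z <-] : q u = 0.
      by rewrite -q'E u0 linear0.
    exact: fr.
  by have [g gE] := H f'; exists g => u; rewrite -q'E gE f'E.
have [fq fqE] := comp_lin f q'; have [|g gE] := H fq.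
  move=> z; rewrite fqE (_ : q' _ = 0) ?linear0 //.
  by apply: kerv_inj; rewrite q'E linear0; apply/rqe; exists z.
by exists g => u; have [x <-] := eq' u; rewrite /= q'E gE fqE.
Qed.

Lemma xExt_iso (x : A) i V V' W (e : {linear V -> V'}) : injective e -> epi e ->
  xExt x i V W <-> xExt x i V' W.
Proof.
move=> ie ee; have [U [P [q [p [qp prP]]]]] := enough_proj V.
have [p' p'E] := comp_lin e p.
have qp' : ses q p'.
  have [iq ep qpe] := qp; split=> // [y|y].
    have [v <-] := ee y; have [z <-] := ep v; by exists z.
  rewrite p'E -qpe; split=> [|->]; last by rewrite linear0.
  by move/(proj1 (lin_inj0 e) ie).
by rewrite /xExt (xextP _ _ qp prP) (xextP _ _ qp' prP).
Qed.

Lemma Ext_projective i P W : projective P -> ExtV i P W.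
Proof.
move=> prP; rewrite /ExtV /xExt; apply/(Ext1_lift _ (env_ses _)).
  exact: inj_env_injective.
by move=> f; have [_ er _] := env_ses (cosyzygy W i); apply: prP er.
Qed.

Lemma Ext_injective i V I : injective_module I -> ExtV i V I.
Proof.
move=> injI; apply/xExt_syzygy.
apply/(Ext1P _ (syzygy_ses V i) (@free_projective _ _)) => f.
by have [iq _ _] := syzygy_ses V i; apply: injI.
Qed.

Section TwoOutOfThree.
Variables (V1 V2 V3 : lmodType A) (a : {linear V1 -> V2}) (b : {linear V2 -> V3}).
Hypothesis ab : ses a b.
Variable W : lmodType A.

(** Two fragments of the long exact sequence in the first variable, obtained by
    lifting maps into cosyzygies of W. *)
Lemma Ext_middle i : ExtV i V1 W -> ExtV i V3 W -> ExtV i V2 W.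
Proof.
rewrite /ExtV /xExt; move: (cosyzygy W i) => Wi H1 H3.
have jr := env_ses Wi; have injJ := @inj_env_injective _ Wi.
apply/(Ext1_lift _ jr injJ) => f.
have [fa faE] := comp_lin f a.
have [g gE] := (Ext1_lift _ jr injJ).1 H1 fa.
have [ia eb abe] := ab.
have [h hE] := injJ _ _ a g ia; have [rh rhE] := comp_lin (env_out Wi) h.
have [d dE] := sub_lin f rh.
have [k kE] : exists k : {linear V3 -> cosyz Wi}, forall v, k (b v) = d v.
  by apply: (ses_out ab) => u; rewrite dE rhE hE gE faE subrr.
have [l lE] := (Ext1_lift _ jr injJ).1 H3 k.
have [lb lbE] := comp_lin l b; have [hl hlE] := add_lin lb h.
by exists hl => v; rewrite hlE linearD lbE lE kE dE rhE subrK.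
Qed.

Lemma Ext_coker i : ExtV i V1 W -> ExtV i.+1 V2 W -> ExtV i.+1 V3 W.
Proof.
rewrite /ExtV /xExt /=; move: (cosyzygy W i) => W0; set W1 := cosyz W0.
move=> H1 H2; have jr := env_ses W0; have injJ := @inj_env_injective _ W0.
have jr1 := env_ses W1; have injJ1 := @inj_env_injective _ W1.
apply/(Ext1_lift _ jr1 injJ1) => f; have [fb fbE] := comp_lin f b.
have [g gE] := (Ext1_lift _ jr1 injJ1).1 H2 fb; have [ga gaE] := comp_lin g a.
have [h hE] : exists h : {linear V1 -> W1}, forall v, env_in W1 (h v) = ga v.
  by apply: (ses_into jr1) => v; rewrite gaE gE fbE (ses_comp0 ab) linear0.
have [k kE] := (Ext1_lift _ jr injJ).1 H1 h; have [ia eb abe] := ab.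
have [l lE] := injJ _ _ a k ia.
have [rl rlE] := comp_lin (env_out W0) l.
have [irl irlE] := comp_lin (env_in W1) rl.
have [d dE] := sub_lin g irl.
have [s sE] : exists s : {linear V3 -> inj_env W1}, forall v, s (b v) = d v.
  apply: (ses_out ab) => u.
  by rewrite dE irlE rlE lE kE hE gaE subrr.
exists s => v; have [u <-] := eb v.
by rewrite sE dE irlE linearB gE fbE (ses_comp0 jr1) subr0.
Qed.

End TwoOutOfThree.

Lemma homology0 U V W (f : {linear U -> V}) (g : {linear V -> W}) :
  is_zero (homology f g) <-> forall y, g y = 0 -> exists u, f u = y.
Proof.
have sS : submodule [set z : kerm g | exists u : U, f u = kerv z].
  split=> [|a z t [u uE] [v vE]]; first by exists 0; rewrite !linear0.
  by exists (a *: u + v); rewrite !linearP uE vE.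
split=> [H y /to_kerm[z <-]|H z].
  by have /(qpi0 _ sS) := H (qpi _ z).
have [y <-] := qpi_surj z.
by apply/(qpi0 _ sS)/H/kerv0.
Qed.

Lemma Ext_vanish i V W : is_zero (Ext i.+1 V W) <-> ExtV i V W.
Proof.
rewrite homology0 /ExtV xExt_syzygy -[xext _ _ _]/(ExtV 0 (syzygy V i) W).
rewrite (@Ext1_presentation _ _ _ (syzygy V i) W _ _ _ (@free_cover_surj _ _)
  (@free_cover_exact A V i) (@free_res_exact A V i) (@free_projective _ _)).
split=> H f.
  move=> fr; have [|g gE] := H (to_hom f).
    by apply: homP => x; rewrite /= fr.
  by exists (homv g) => u; rewrite -[RHS]/(homv (to_hom f) u) -gE.
move=> f0; have [|g gE] := H (homv f).
  by move=> z; have /= := congr1 (fun h => homv h z) f0.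
by exists (to_hom g); apply: homP.
Qed.

End ExtTheory.

(** * Duality, Tor and flat dimension *)

Section Duality.
Variable A : comNzRingType.
Implicit Types U V W P Q X Y Z J I E F L M N R : lmodType A.

Lemma flip U V W (f : {linear U -> hom V W}) :
  exists g : {linear V -> hom U W}, forall u v, homv (g v) u = homv (f u) v.
Proof.
have lf v : linear (fun u => homv (f u) v).
  by move=> a x y; rewrite linearP.
have lg : linear (fun v => to_hom (mklin (lf v))).
  by move=> a x y; apply: homP => u /=; rewrite lin_hom.
by exists (mklin lg).
Qed.

Lemma dual_ses U V W I (i : {linear U -> V}) (p : {linear V -> W}) :
  ses i p -> injective_module I -> ses (precomp I p) (precomp I i).
Proof.
move=> ip injI; have [ii ep ipe] := ip; split.
- move=> f g fg; apply: homP => w; have [v <-] := ep w.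
  by have /= := congr1 (fun h => homv h v) fg.
- move=> f; have [g gE] := injI _ _ i (homv f) ii.
  by exists (to_hom g); apply: homP.
- move=> f; split=> [f0|[g <-]].
    have [g gE] : exists g : {linear W -> I}, forall v, g (p v) = homv f v.
      by apply: (ses_out ip) => u; have /= := congr1 (fun h => homv h u) f0.
    by exists (to_hom g); apply: homP.
  by apply: homP => u; rewrite /= (ses_comp0 ip) linear0.
Qed.

(** A map into the dual of P becomes, on exchanging the variables, a map out of
    P, and then projectivity applies. *)
Lemma dual_injective P : projective P -> injective_module (cdual P).
Proof.
move=> prP U V j g ij; have [g' gE] := flip g.
have ej : epi (precomp (chars A) j).
  move=> f; have [h hE] := @chars_injective A _ _ j (homv f) ij.
  by exists (to_hom h); apply: homP.
have [h hE] := prP _ _ _ g' ej; have [h' h'E] := flip h.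
exists h' => u; apply: homP => p; rewrite h'E -gE -hE.
by [].
Qed.

(** Ext of a character dual is symmetric: both sides describe bilinear maps,
    namely the characters of Tor. *)
Lemma Ext_balance i V N : ExtV i V (cdual N) <-> ExtV i N (cdual V).
Proof.
elim: i N => [|i IHi] N; have [N' [R [q [p [qp prR]]]]] := enough_proj N;
  have dqp := dual_ses qp (@chars_injective A).
  rewrite (Ext1P _ qp prR) (Ext1_lift _ dqp (dual_injective prR)).
  split=> H f; have [f' f'E] := flip f; have [g gE] := H f';
      have [g' g'E] := flip g; exists g' => u.
    by apply: homP => v; rewrite g'E -f'E -gE.
  by apply: homP => v; rewrite -f'E -gE /= g'E.
rewrite (Ext_shiftJ _ _ dqp (dual_injective prR)) (Ext_shiftP _ _ qp prR).
exact: IHi.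
Qed.

Lemma tensor_ext U V W (f g : {linear tensor U V -> W}) :
  (forall u v, f (tens u v) = g (tens u v)) -> forall z, f z = g z.
Proof.
move=> fg z; have [x <-] := qpi_surj z.
elim/freeg_gen: x => [|a [u v] y IH]; first by rewrite !linear0.
by rewrite !linearP IH; congr (_ *: _ + _); exact: fg.
Qed.

Lemma tensor_lift U V W (f : {linear U -> hom V W}) :
  exists g : {linear tensor U V -> W}, forall u v, g (tens u v) = homv (f u) v.
Proof.
pose h : {linear {freeg (U * V)%type / A} -> W} :=
  free_lift (fun x : U * V => homv (f x.1) x.2).
have hE u v : h << (u, v) >> = homv (f u) v.
  by rewrite /h /= /free_lift liftU scale1r.
have [g gE] : exists g : {linear tensor U V -> W},
    forall x, g (qpi _ x) = h x.
  apply: factor_surj => [|z]; first exact: qpi_surj.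
  rewrite -[0 in X in X -> _](linear0 (qpi _)) => /qpi_eq; rewrite subr0.
  move=> /(_ [set z | h z = 0]); apply.
  split; first exact: submodule_ker.
  move=> {}z [[a [x [x' [y ->]]]]|[a [x [y [y' ->]]]]];
    rewrite /mkset linearB linearP !hE.
    by rewrite linearP /= subrr.
  by rewrite lin_hom subrr.
by exists g => u v; rewrite [LHS]gE hE.
Qed.

Lemma tens_linear U V : exists f : {linear U -> hom V (tensor U V)},
  forall u v, homv (f u) v = tens u v.
Proof.
have l1 (u : U) : linear (fun v : V => tens u v).
  by move=> a x y; exact: tensPr.
have l2 : linear (fun u => to_hom (mklin (l1 u))).
  by move=> a x y; apply: homP => v; exact: tensPl.
by exists (mklin l2).
Qed.

Lemma tensor_curry U V W (g : {linear tensor U V -> W}) :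
  exists f : {linear U -> hom V W}, forall u v, homv (f u) v = g (tens u v).
Proof.
have [t tE] := tens_linear U V.
have lf : linear (fun u => to_hom (mklin (linearP (g \o homv (t u))))).
  by move=> a x y; apply: homP => v /=; rewrite linearP /= linearP.
by exists (mklin lf) => u v /=; rewrite tE.
Qed.

Lemma flat_dual F : flat F -> injective_module (cdual F).
Proof.
move=> flF U V j g ij; have [h hE] := tensor_lift g.
have [k kE] := @chars_injective A _ _ _ h (flF _ _ _ ij).
have [f fE] := tensor_curry k; exists f => u; apply: homP => v.
by rewrite fE -tenslE kE hE.
Qed.

(** An element of the kernel of g outside the image of f would be detected by a
    character that kills the image of f. *)
Lemma chars_exact U V W (f : {linear U -> V}) (g : {linear V -> W}) :
  (forall h : {linear V -> chars A}, (forall u, h (f u) = 0) ->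
     exists k : {linear W -> chars A}, forall v, k (g v) = h v) ->
  forall v, g v = 0 -> exists u, f u = v.
Proof.
move=> H v gv; have [C [p [ep fp]]] := cokernel f; apply/fp.
apply: contrapT => /eqP/chars_cogenerator[c /eqP]; apply.
have [cp cpE] := comp_lin c p; have [|k kE] := H cp.
  by move=> u; rewrite cpE (_ : p _ = 0) ?linear0 //; apply/fp; exists u.
by rewrite -cpE -kE gv linear0.
Qed.

(** By adjunction, the characters of P (x) N are the maps from P to the character
    dual of N. *)
Lemma Tor_vanish i V N : ExtV i V (cdual N) -> is_zero (Tor i.+1 V N).
Proof.
move=> /Ext_vanish/homology0 H; apply/homology0.
apply: chars_exact => h hd; have [f fE] := tensor_curry h.
have [|g gE] := H (to_hom f).
  apply: homP => x; apply: homP => n.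
  by rewrite [LHS]fE -tenslE hd.
have [k kE] := tensor_lift (homv g); exists k => v.
have [kd kdE] := comp_lin k (tensl (free_res_d V i) N).
rewrite -kdE; move: v; apply: tensor_ext => x n; rewrite kdE /= tenslE kE -fE.
by have /= := congr1 (fun t => homv (homv t x) n) gE.
Qed.

Definition bijlin U V (e : {linear U -> V}) := injective e /\ epi e.

(** Finite resolutions in inductive form, as dimension shifting uses them. *)
Fixpoint has_res (P : lmodType A -> Prop) n N : Prop :=
  if n is k.+1 then
    exists N' F (i : {linear N' -> F}) (p : {linear F -> N}),
      [/\ ses i p, P F & has_res P k N']
  else exists F (e : {linear F -> N}), bijlin e /\ P F.

Lemma resolution_has_res (P : lmodType A -> Prop) n N (F : resolution N) :
  (forall i, (i <= n)%N -> P (F i)) -> (forall i, (n < i)%N -> is_zero (F i)) ->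
  has_res P n N.
Proof.
elim: n N F => [|n IHn] N F PF F0 /=.
  exists (F 0), (res_aug F); split; last exact: PF.
  split; last exact: res_aug_surj.
  apply/lin_inj0 => x /(@res_exact0 _ _ F)[y <-].
  by rewrite (F0 1 isT y) linear0.
pose K := kerm (res_aug F).
have [d dE] : exists d : {linear F 1 -> K}, forall x, kerv (d x) = res_d F 0 x.
  apply: corestrict => [|x]; first exact: kerv_inj.
  by apply/kerv_exact/(@res_exact0 _ _ F); exists x.
have dsurj z : exists y, d y = z.
  have /(@res_exact0 _ _ F)[y yE] := kerv0 z; exists y; apply: kerv_inj.
  by rewrite dE.
have dex : exact (res_d F 1) d.
  move=> y; rewrite -(@res_exactS _ _ F 0); split=> [y0|y0].
    by rewrite -dE y0 linear0.
  by apply: kerv_inj; rewrite dE y0 linear0.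
exists K, (F 0), (@kerv A _ _ (res_aug F)), (res_aug F); split.
- by split; [exact: kerv_inj|exact: res_aug_surj|exact: kerv_exact].
- exact: PF.
apply: (IHn K (@Resolution A K (fun i => F i.+1) (fun i => res_d F i.+1) d
  dsurj dex (fun i => @res_exactS _ _ F i.+1))) => i ni; first exact: PF.
exact: F0.
Qed.

(** The character dual of a flat module is injective, so flat modules have no
    higher Ext with values in a character dual. *)
Lemma flat_dim_Ext N : finite_flat_dim N ->
  exists n, forall V i, (n <= i)%N -> ExtV i N (cdual V).
Proof.
move=> [n [F [PF F0]]]; exists n; have := resolution_has_res PF F0.
have flE F' V i : flat F' -> ExtV i F' (cdual V).
  by move=> flF; apply/Ext_balance/Ext_injective/flat_dual.
elim: n N {F PF F0} => [|n IHn] N /=.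
  move=> [F [e [[ie ee] flF]]] V i _.
  by rewrite /ExtV -(xExt_iso 0 i (cdual V) ie ee); apply: flE.
move=> [N' [F [j [p [jp flF /IHn HN']]]]] V [//|i] ni.
by apply: (Ext_coker jp); [apply: HN'|apply: flE].
Qed.

End Duality.

(** * Finitely generated modules over noetherian local rings *)

Section Spans.
Variable A : comNzRingType.
Implicit Types U V W P Q X Y Z J I E F L M N R : lmodType A.

Fixpoint lspan V (s : seq V) : set V :=
  if s is v :: s' then [set x | exists a, lspan s' (x - a *: v)]
  else [set 0].

Lemma submodule_lspan V (s : seq V) : submodule (lspan s).
Proof.
elim: s => [|v s [IH0 IHD]] /=.
  by split=> // a u w /= -> ->; rewrite scaler0 addr0.
split=> [|a u w [b ub] [c wc]]; first by exists 0; rewrite scale0r subr0.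
exists (a * b + c); rewrite scalerDl -scalerA opprD addrACA -scalerBr.
exact: IHD.
Qed.

Lemma lspan_mem V (s : seq V) x : x \in s -> lspan s x.
Proof.
elim: s => // v s IHs; rewrite inE => /orP[/eqP-> | /IHs xs] /=.
  by exists 1; rewrite scale1r subrr; case: (submodule_lspan s).
by exists 0; rewrite scale0r subr0.
Qed.

Lemma lspan_sub V (s : seq V) (S : set V) : submodule S ->
  (forall x, x \in s -> S x) -> forall x, lspan s x -> S x.
Proof.
move=> sS; elim: s => [|v s IHs] sub x /=; first by move=> ->; case: sS.
move=> [a /IHs xa]; rewrite -[x](subrK (a *: v)); apply: submoduleD => //.
  by apply: xa => y ys; apply: sub; rewrite inE ys orbT.
by apply: submoduleZ => //; apply: sub; rewrite inE eqxx.
Qed.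

Lemma lspan_subset V (s t : seq V) : {subset s <= t} -> lspan s `<=` lspan t.
Proof.
move=> st; apply: lspan_sub; first exact: submodule_lspan.
by move=> x /st/lspan_mem.
Qed.

Lemma submodule_sum V (S : set V) (n : nat) (c : 'I_n -> A) (g : 'I_n -> V) :
  submodule S -> (forall i, S (g i)) -> S (\sum_(i < n) c i *: g i).
Proof.
move=> sS Sg; apply: (big_ind S); first by case: sS.
  by move=> x y; apply: submoduleD.
by move=> i _; apply: submoduleZ.
Qed.

Lemma submodule_preim U V (f : {linear U -> V}) (S : set V) :
  submodule S -> submodule [set x | S (f x)].
Proof.
move=> [S0 SD]; split=> [|a u v Su Sv]; rewrite /mkset ?linear0 // linearP.
exact: SD.
Qed.

Lemma submoduleI V (S T : set V) :
  submodule S -> submodule T -> submodule (S `&` T).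
Proof.
by move=> [S0 SD] [T0 TD]; split=> // a u v [? ?] [? ?]; split; auto.
Qed.

Definition fgset V (S : set V) : Prop :=
  exists s : seq V, (forall x, x \in s -> S x) /\ S `<=` lspan s.

Lemma lin_span_lspan V n (g : 'I_n -> V) x :
  lin_span g x <-> lspan [seq g i | i <- enum 'I_n] x.
Proof.
split=> [[c ->]|].
  apply: submodule_sum => [|i]; first exact: submodule_lspan.
  by apply/lspan_mem/map_f; rewrite mem_enum.
apply: lspan_sub => [|y /mapP[i _ ->]].
  split=> [|a u v [c ->] [d ->]].
    by exists (fun=> 0); rewrite big1 // => i _; rewrite scale0r.
  exists (fun i => a * c i + d i); rewrite scaler_sumr -big_split /=.
  by apply: eq_bigr => i _; rewrite scalerDl scalerA.
exists (fun j => (j == i)%:R); rewrite (bigD1 i) //= eqxx scale1r big1 ?addr0 //.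
by move=> j /negPf->; rewrite scale0r.
Qed.

Lemma finite_typeP V : finite_type V <-> exists s : seq V, forall x, lspan s x.
Proof.
split=> [[n [g gE]]|[s sE]].
  by exists [seq g i | i <- enum 'I_n] => x; apply/lin_span_lspan; rewrite gE.
exists (size s), (fun i => nth 0 s i); apply/seteqP; split=> // x _.
apply/lin_span_lspan; apply: lspan_subset (sE x) => y ys.
apply/mapP; have ys' := ys; rewrite -index_mem in ys'.
by exists (Ordinal ys'); rewrite ?mem_enum //= nth_index.
Qed.

Lemma fgset_ext U V (f : {linear U -> V}) (S : set U) : submodule S ->
  fgset [set y | exists2 x, S x & f x = y] ->
  fgset (S `&` [set x | f x = 0]) -> fgset S.
Proof.
move=> sS [t [tS tE]] [k [kS kE]].
have [l [lS lt]] : exists l : seq U, (forall x, x \in l -> S x) /\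
    (forall y, y \in t -> exists2 x, x \in l & f x = y).
  elim: t tS {tE} => [|y t IH] tS; first by exists [::].
  have [|l [lS lt]] := IH; first by move=> z zt; apply: tS; rewrite inE zt orbT.
  have [x Sx xy] := tS y (mem_head _ _).
  exists (x :: l); split=> [z|z]; rewrite inE => /predU1P[->//|].
  - exact: lS.
  - by exists x; rewrite ?mem_head.
  - by move=> /lt[w wl wz]; exists w; rewrite // inE wl orbT.
exists (l ++ k); split=> [x|x Sx].
  by rewrite mem_cat => /orP[/lS //|/kS[]].
have : [set y | exists2 z, lspan l z & f z = y] (f x).
  apply: lspan_sub (tE (f x) _); last by exists x.
    split=> [|a _ _ [z lz <-] [w lw <-]].
      by exists 0; rewrite ?linear0 //; case: (submodule_lspan l).
    exists (a *: z + w); rewrite ?linearP //.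
    by case: (submodule_lspan l) => _; apply.
  by move=> y /lt[z zl zy]; exists z => //; apply: lspan_mem.
move=> [z lz fz]; rewrite -[x](subrK z); apply: submoduleD.
- exact: submodule_lspan.
- apply: (@lspan_subset _ k) => [w wk|]; first by rewrite mem_cat wk orbT.
  apply: kE; split; last by rewrite /mkset linearB fz subrr.
  by apply: submoduleB => //; apply: lspan_sub lz.
- by apply: lspan_subset lz => w wl; rewrite mem_cat wl.
Qed.

(** Induction on the generators: the coefficients of the first one form an ideal,
    and once they are accounted for, what remains lies in the span of the
    others. *)
Lemma noetherian_sub V (s : seq V) (S : set V) : noetherian A ->
  submodule S -> S `<=` lspan s -> fgset S.
Proof.
move=> nA; elim: s S => [|v s IHs] S sS Ss.
  by exists [::]; split.
pose J := [set c : A | exists t, lspan s t /\ S (c *: v + t)].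
have iJ : ideal J.
  have [l0 lD] := submodule_lspan s; have [S0 SD] := sS.
  split=> [|a b c [t [ts tS]] [u [us uS]]].
    by exists 0; rewrite scale0r addr0.
  exists (a *: t + u); split; first exact: lD.
  rewrite scalerDl -scalerA addrACA -scalerDr; exact: SD.
have [n [g gE]] := nA J iJ.
have hw i : exists w, S w /\ exists2 t, lspan s t & w = g i *: v + t.
  have : J (g i).
    rewrite gE; exists (fun j => (j == i)%:R).
    rewrite (bigD1 i) //= eqxx scale1r big1 ?addr0 // => j /negPf->.
    by rewrite scale0r.
  by move=> [t [ts tS]]; exists (g i *: v + t); split=> //; exists t.
pose w i := projT1 (cid (hw i)).
have wE i : S (w i) /\ exists2 t, lspan s t & w i = g i *: v + t.
  by rewrite /w; case: cid.
have [k [kS kE]] := IHs _ (submoduleI sS (submodule_lspan s)) (fun x => @proj2 _ _).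
exists ([seq w i | i <- enum 'I_n] ++ k); split=> [x|x Sx].
  by rewrite mem_cat => /orP[/mapP[i _ ->]|/kS[]//]; case: (wE i).
have [a xa] := Ss x Sx.
have : J a by exists (x - a *: v); split=> //; rewrite addrC subrK.
rewrite gE => -[c aE].
have sl := submodule_lspan ([seq w i | i <- enum 'I_n] ++ k).
rewrite -[x](subrK (\sum_i c i *: w i)); apply: submoduleD => //; last first.
  apply: submodule_sum => // i; apply: lspan_mem; rewrite mem_cat map_f //.
  by rewrite mem_enum.
apply: (@lspan_subset _ k) => [y yk|]; first by rewrite mem_cat yk orbT.
apply: kE; split.
  by apply: submoduleB => //; apply: submodule_sum => // i; case: (wE i).
have [t tE] : exists t, forall i : 'I_n, lspan s (t i) /\ w i = g i *: v + t i.
  have ht i : exists t, lspan s t /\ w i = g i *: v + t.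
    by have [_ [t]] := wE i; exists t.
  by exists (fun i => projT1 (cid (ht i))) => i; case: cid.
have -> : x - \sum_i c i *: w i = (x - a *: v) - \sum_i c i *: t i.
  rewrite aE scaler_suml -addrA -opprD -big_split /=; congr (_ - _).
  by apply: eq_bigr => i _; rewrite (tE i).2 scalerDr scalerA.
apply: submoduleB => //; first exact: submodule_lspan.
by apply: submodule_sum => [|i]; [exact: submodule_lspan|case: (tE i)].
Qed.

Lemma fg_epi U V (p : {linear U -> V}) :
  epi p -> finite_type U -> finite_type V.
Proof.
move=> ep /finite_typeP[s sU]; apply/finite_typeP; exists (map p s) => y.
have [x <-] := ep y; move: (sU x).
apply: (lspan_sub (submodule_preim p (submodule_lspan _))) => z zs.
exact/lspan_mem/map_f.
Qed.

Lemma fgset_type U V (i : {linear U -> V}) : injective i ->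
  fgset [set y | exists x, i x = y] -> finite_type U.
Proof.
move=> ii [s [sS sE]]; apply/finite_typeP.
have [t tE] : exists t : seq U, map i t = s.
  elim: s sS {sE} => [|y s IH] sS; first by exists [::].
  have [|t <-] := IH; first by move=> z zs; apply: sS; rewrite inE zs orbT.
  by have [x <-] := sS y (mem_head _ _); exists (x :: t).
exists t => x; have : lspan s (i x) by apply: sE; exists x.
have : lspan s `<=` [set y | exists2 z, lspan t z & i z = y].
  apply: lspan_sub => [|y].
    split=> [|a _ _ [z lz <-] [w lw <-]].
      by exists 0; rewrite ?linear0 //; case: (submodule_lspan t).
    exists (a *: z + w); rewrite ?linearP //.
    by case: (submodule_lspan t) => _; apply.
  by rewrite -tE => /mapP[z zt ->]; exists z => //; apply: lspan_mem.
by move=> sub /sub[z tz /ii <-].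
Qed.

Lemma fg_inj U V (i : {linear U -> V}) : noetherian A ->
  injective i -> finite_type V -> finite_type U.
Proof.
move=> nA ii /finite_typeP[s sV]; apply: (fgset_type ii).
exact: (@noetherian_sub _ s _ nA (submodule_range i)).
Qed.

Lemma fg_rV n : finite_type 'rV[A]_n.
Proof.
exists n, (fun i => delta_mx 0 i); apply/seteqP; split=> // x _.
by exists (fun i => x 0 i); rewrite {1}[x]row_sum_delta.
Qed.

Lemma rV_projective n : projective 'rV[A]_n.
Proof.
move=> U V p g ep.
have hk (k : 'I_n) : exists u, p u = g (delta_mx 0 k) by apply: ep.
pose f k := projT1 (cid (hk k)).
have fE k : p (f k) = g (delta_mx 0 k) by rewrite /f; case: cid.
have lf : linear (fun x : 'rV[A]_n => \sum_i x 0 i *: f i).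
  move=> a x y; rewrite scaler_sumr -big_split /=.
  by apply: eq_bigr => i _; rewrite !mxE scalerDl scalerA.
exists (mklin lf) => x /=; rewrite {2}[x]row_sum_delta !linear_sum.
by apply: eq_bigr => i _; rewrite !(lin_scale p) (lin_scale g) fE.
Qed.

Lemma fg_cover V : finite_type V ->
  exists n (p : {linear 'rV[A]_n -> V}), epi p.
Proof.
move=> [n [g gE]].
have lf : linear (fun x : 'rV[A]_n => \sum_i x 0 i *: g i).
  move=> a x y; rewrite scaler_sumr -big_split /=.
  by apply: eq_bigr => i _; rewrite !mxE scalerDl scalerA.
exists n, (mklin lf) => y.
have [c ->] : lin_span g y by rewrite gE.
by exists (\row_i c i) => /=; apply: eq_bigr => i _; rewrite mxE.
Qed.

Lemma fg_ses V : noetherian A -> finite_type V ->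
  exists n U (q : {linear U -> 'rV[A]_n}) (p : {linear 'rV[A]_n -> V}),
    ses q p /\ finite_type U.
Proof.
move=> nA /fg_cover[n [p ep]].
exists n, (kerm p), (@kerv A _ _ p), p; split.
  by split; [exact: kerv_inj|by []|exact: kerv_exact].
exact: (fg_inj nA (@kerv_inj _ _ _ p) (fg_rV n)).
Qed.

Lemma fg_syzygy i V : noetherian A -> finite_type V ->
  exists Z, finite_type Z /\ forall (x : A) W, xExt x i V W <-> xExt x 0 Z W.
Proof.
move=> nA; elim: i V => [|i IHi] V fV; first by exists V.
have [n [U [q [p [qp /IHi[Z [fZ ZE]]]]]]] := fg_ses nA fV.
exists Z; split=> // x W; rewrite -ZE.
exact: (xExt_syz _ _ _ qp (@rV_projective n)).
Qed.

End Spans.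

Section Local.
Variables (A : comNzRingType) (m : set A).
Hypothesis lA : local_ring m.

Lemma ideal_maximal : ideal m. Proof. by case: lA => -[]. Qed.

Lemma maximal_not1 : ~ m 1.
Proof.
case: lA => -[im mT _] _ m1; apply: mT; apply/seteqP; split=> // a _.
by rewrite -[a]mulr1; apply: (submoduleZ a im m1).
Qed.

Lemma proper_sub_maximal (J : set A) : ideal J -> ~ J 1 -> J `<=` m.
Proof.
move=> iJ J1; pose P := [set X : set A | [/\ ideal X, ~ X 1 & J `<=` X]].
have [|//|X [[iX X1 JX] maxX]] := @Zorn_set _ P J.
  by split.
  move=> F [X0 FX0] FP totF; split.
  - split=> [|a x y [X FX Xx] [Y FY Yy]].
      by exists X0 => //; have [[]] := FP _ FX0.
    have [XY|YX] := totF _ _ FX FY.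
      by exists Y => //; have [[_ +] _ _] := FP _ FY; apply => //; apply: XY.
    by exists X => //; have [[_ +] _ _] := FP _ FX; apply => //; apply: YX.
  - by move=> [X FX X1]; have [] := FP _ FX.
  - by move=> x Jx; exists X0 => //; have [_ _] := FP _ FX0; apply.
suff -> : m = X by [].
apply/esym; case: lA => _; apply; split=> //.
  by move=> XT; apply: X1; rewrite XT.
move=> Y iY XY; have [Y1|Y1] := pselect (Y 1); last first.
  by left; apply: maxX => //; split=> // x /JX/XY.
right; apply/seteqP; split=> // a _.
by rewrite -[a]mulr1; apply: (submoduleZ a iY Y1).
Qed.

Lemma unit_of_notin a : ~ m a -> exists b, b * a = 1.
Proof.
move=> ma; apply: contrapT => nu; apply: ma.
apply: (@proper_sub_maximal [set x | exists b, x = b * a]).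
- split=> [|c _ _ [x ->] [y ->]]; first by exists 0; rewrite mul0r.
  by exists (c * x + y); rewrite mulrDl -mulrA.
- by move=> [b b1]; apply: nu; exists b.
- by exists 1; rewrite mul1r.
Qed.

(** Nakayama's lemma for B + xH. The equation for the first generator v can be
    solved for v because its coefficient 1 - xa is a unit, which removes v from
    the list of generators. *)
Lemma nakayama (V : lmodType A) (B : set V) x (s : seq V) :
  submodule B -> m x ->
  (forall u, u \in s -> exists b h, [/\ B b, lspan s h & u = b + x *: h]) ->
  forall u, u \in s -> B u.
Proof.
move=> sB mx; elim: s => // v s IHs H.
have sl := submodule_lspan s.
have [b [h [Bb hs vE]]] := H v (mem_head _ _).
have [a ha] := hs.
have [c cE] : exists c, c * (1 - x * a) = 1.
  apply: unit_of_notin => m1; apply: maximal_not1.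
  rewrite -(subrK (x * a) 1); apply: (submoduleD ideal_maximal) => //.
  by rewrite mulrC; apply: (submoduleZ a ideal_maximal).
have vE' : v = c *: b + x *: (c *: (h - a *: v)).
  rewrite -[LHS]scale1r -cE -scalerA.
  have -> : (1 - x * a) *: v = b + x *: (h - a *: v).
    by rewrite scalerBl scale1r {1}vE scalerBr scalerA addrA.
  by rewrite scalerDr !scalerA [c * x]mulrC.
set w := c *: (h - a *: v) in vE'; set w' := c *: b in vE'.
have Hs u : u \in s -> B u.
  apply: IHs => {}u us.
  have [|b' [h' [Bb' [a' hs'] uE]]] := H u; first by rewrite inE us orbT.
  exists (b' + (x * a') *: w'), (h' - a' *: v + (x * a') *: w).
  split.
  - apply: (submoduleD sB) => //.
    exact: (submoduleZ _ sB (submoduleZ _ sB Bb)).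
  - apply: (submoduleD sl) => //.
    exact: (submoduleZ _ sl (submoduleZ _ sl ha)).
  - rewrite uE -addrA; congr (_ + _); rewrite -{1}[h'](subrK (a' *: v)).
    rewrite [LHS]scalerDr [x *: (_ + _ *: w)]scalerDr addrCA; congr (_ + _).
    rewrite scalerA {1}vE' scalerDr; congr (_ + _).
    by rewrite [LHS]scalerA [RHS]scalerA mulrC.
move=> u; rewrite inE => /orP[/eqP->|/Hs //]; rewrite vE'.
apply: (submoduleD sB); first exact: (submoduleZ _ sB).
apply: (submoduleZ _ sB); apply: (submoduleZ _ sB).
exact: (lspan_sub sB Hs).
Qed.

Hypothesis nA : noetherian A.

(** Noetherian induction: a union of a chain of ideals is finitely generated,
    hence is a member of the chain. *)
Lemma noetherian_ind (P : set A -> Prop) :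
  (forall J, ideal J -> (forall J', ideal J' -> J `<=` J' -> J' <> J -> P J') ->
     P J) ->
  forall J, ideal J -> P J.
Proof.
move=> ind J0 iJ0; apply: contrapT => nP0.
pose Q := [set J : set A | ideal J /\ ~ P J].
have [||J [[iJ nPJ] maxJ]] := @Zorn_set _ Q J0; first by split.
  move=> F [X0 FX0] FQ totF.
  have iU : ideal (\bigcup_(X in F) X).
    split=> [|a x y [X FX Xx] [Y FY Yy]].
      by exists X0 => //; have [[]] := FQ _ FX0.
    have [XY|YX] := totF _ _ FX FY.
      by exists Y => //; have [[_ +] _] := FQ _ FY; apply => //; apply: XY.
    by exists X => //; have [[_ +] _] := FQ _ FX; apply => //; apply: YX.
  have [n [g gE]] := nA iU.
  have [X FX gX] : exists2 X, F X & forall i, X (g i).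
    have hg i : exists2 X, F X & X (g i).
      suff : (\bigcup_(X in F) X) (g i) by move=> [X]; exists X.
      rewrite gE; apply/lin_span_lspan/lspan_mem/map_f.
      by rewrite mem_enum.
    suff : exists2 X, F X & forall i, i \in enum 'I_n -> X (g i).
      by move=> [X FX H]; exists X => // i; apply: H; rewrite mem_enum.
    elim: (enum 'I_n) => [|i e [X FX IH]]; first by exists X0.
    have [Y FY Yi] := hg i; have [XY|YX] := totF _ _ FX FY.
      by exists Y => // k; rewrite inE => /predU1P[->//|/IH]; apply: XY.
    by exists X => // k; rewrite inE => /predU1P[->|/IH//]; apply: YX.
  have -> : \bigcup_(X in F) X = X; last exact: FQ.
  apply/seteqP; split=> [x|x Xx]; last by exists X.
  have [iX _] := FQ _ FX.
  by rewrite gE => -[c ->]; apply: (submodule_sum _ iX).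
apply/nPJ/ind => // J' iJ' JJ' neJ; apply: contrapT => nPJ'.
by apply: neJ; apply: maxJ.
Qed.

End Local.

(** * The injective hull of the residue field *)

Section Hull.
Variable A : comNzRingType.
Implicit Types U V E : lmodType A.

Definition max_disjoint V (T X : set V) : Prop :=
  [/\ submodule X, forall x, X x -> T x -> x = 0 &
      forall X', submodule X' -> (forall x, X' x -> T x -> x = 0) ->
        X `<=` X' -> X' = X].

Lemma max_disjoint_exists V (S T : set V) : submodule S ->
  (forall x, S x -> T x -> x = 0) -> exists2 X, max_disjoint T X & S `<=` X.
Proof.
move=> sS dST; pose P := [set X : set V |
  [/\ submodule X, forall x, X x -> T x -> x = 0 & S `<=` X]].
have [||X [[sX dX SX] maxX]] := @Zorn_set _ P S; first by split.
  move=> F [X0 FX0] FP totF; split.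
  - split=> [|a x y [X FX Xx] [Y FY Yy]].
      by exists X0 => //; have [[]] := FP _ FX0.
    have [XY|YX] := totF _ _ FX FY.
      by exists Y => //; have [[_ +] _ _] := FP _ FY; apply => //; apply: XY.
    by exists X => //; have [[_ +] _ _] := FP _ FX; apply => //; apply: YX.
  - by move=> x [X FX Xx]; have [_ + _] := FP _ FX; apply.
  - by move=> x Sx; exists X0 => //; have [_ _] := FP _ FX0; apply.
exists X => //; split=> // X' sX' dX' XX'; apply: maxX => //.
by split=> // x /SX/XX'.
Qed.

Lemma max_disjoint_adjoin V (T X : set V) x : max_disjoint T X -> ~ X x ->
  exists c a, [/\ X c, T (c + a *: x) & c + a *: x <> 0].
Proof.
move=> [sX dX maxX] nXx; apply: contrapT => H; apply: nXx.
suff <- : [set y | exists c a, X c /\ y = c + a *: x] = X.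
  by exists 0, 1; rewrite scale1r add0r; case: sX.
apply: maxX.
- have [X0 XD] := sX; split=> [|b _ _ [c [a [Xc ->]]] [d [a' [Xd ->]]]].
    by exists 0, 0; rewrite scale0r addr0.
  exists (b *: c + d), (b * a + a'); split; first exact: XD.
  by rewrite scalerDr scalerDl scalerA addrACA.
- move=> _ [c [a [Xc ->]]] Tca; apply: contrapT => nz.
  by apply: H; exists c, a.
- by move=> c Xc; exists c, 0; rewrite scale0r addr0.
Qed.

(** C and W below are complements of each other in the sense of maximal
    disjointness. The projection of W + C onto W extends to the whole injective
    module; its image is still disjoint from C, hence is W, which is therefore
    a direct summand. *)
Lemma residue_hull (m : set A) : local_ring m ->
  exists E (e : E), [/\ injective_module E, e <> 0, forall a, m a -> a *: e = 0 &
    forall s, (forall a, m a -> a *: s = 0) -> exists b, s = b *: e].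
Proof.
move=> lA; have im := ideal_maximal lA.
pose I : lmodType A := chars A; have injI : injective_module I := @chars_injective A.
have [e [en0 me]] : exists e : I, e <> 0 /\ forall a, m a -> a *: e = 0.
  have [k [q [_ qE]]] := @quotient_exists A A^o m im.
  have q1 : q (1 : A^o) <> 0 by move/qE/(maximal_not1 lA).
  have [g gn0] := chars_cogenerator (introN eqP q1).
  exists (g (q 1)); split; first exact/eqP.
  move=> a ma; rewrite -!lin_scale (_ : q _ = 0) ?linear0 //; apply/qE.
  by rewrite [a *: _]mulr1.
pose K : set I := [set x | exists b, x = b *: e].
have sK : submodule K.
  split=> [|a _ _ [b ->] [c ->]]; first by exists 0; rewrite scale0r.
  by exists (a * b + c); rewrite scalerDl scalerA.
have s0 : submodule [set 0 : I].
  by split=> // a u v -> ->; rewrite scaler0 addr0.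
have [C maxC _] := max_disjoint_exists s0 (fun x x0 (_ : K x) => x0).
have [sC dC _] := maxC.
have [W maxW KW] := max_disjoint_exists sK (fun x Kx Cx => dC x Cx Kx).
have [sW dW topW] := maxW.
have [E [i [ii iE]]] := submodule_type sW.
have [C' [j [jj jE]]] := submodule_type sC.
have lf : linear (fun x : E * C' => i x.1 + j x.2).
  by move=> a x y; rewrite !linearP scalerDr addrACA.
have lg : linear (fun x : E * C' => i x.1).
  by move=> a x y; rewrite !linearP.
have [h hE] : exists h : {linear I -> I}, forall x, h (mklin lf x) = mklin lg x.
  apply: inj_factor => // -[x y] /= xy; apply: dW; first by apply/iE; exists x.
  by rewrite (_ : i x = - j y); [apply: (submoduleN sC); apply/jE; exists y
    |apply/eqP; rewrite -addr_eq0; apply/eqP].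
have hW w : W w -> h w = w.
  by move=> /iE[x <-]; have /= := hE (x, 0); rewrite linear0 addr0.
have hC c : C c -> h c = 0.
  by move=> /jE[y <-]; have /= := hE (0, y); rewrite linear0 add0r.
have imW y : W (h y).
  suff <- : [set z | exists y, h y = z] = W by exists y.
  apply: topW; first exact: submodule_range.
    move=> _ [x <-] Chx; have [Cx|nCx] := pselect (C x); first exact: hC.
    have [c [a [Cc Kt tn0]]] := max_disjoint_adjoin maxC nCx.
    case: tn0; apply: dW; first exact: KW.
    rewrite -(hW _ (KW _ Kt)) linearD (hC _ Cc) add0r lin_scale.
    exact: (submoduleZ _ sC).
  by move=> w Ww; exists w; apply: hW.
have [r rE] : exists r : {linear I -> E}, forall y, i (r y) = h y.
  by apply: corestrict => // y; apply/iE.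
have [e' e'E] : exists x, i x = e.
  by apply/iE/KW; exists 1; rewrite scale1r.
exists E, e'; split.
- move=> U V f g fi; have [ig igE] := comp_lin i g.
  have [k kE] := injI _ _ f ig fi; have [rk rkE] := comp_lin r k.
  exists rk => u; apply: ii; rewrite rkE rE kE igE hW //.
  by apply/iE; exists (g u).
- by move=> e0; apply: en0; rewrite -e'E e0 linear0.
- by move=> a ma; apply: ii; rewrite lin_scale e'E me // linear0.
- move=> s ms; have [->|/eqP sn0] := eqVneq s 0.
    by exists 0; rewrite scale0r.
  have nCs : ~ C (i s).
    by move=> Cs; apply/sn0/ii; rewrite linear0; apply: dW => //; apply/iE; exists s.
  have [c [a [Cc Kt tn0]]] := max_disjoint_adjoin maxC nCs.
  have Ws : W (i s) by apply/iE; exists s.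
  have c0 : c = 0.
    apply: dW => //; rewrite -(addrK (a *: i s) c).
    apply: (submoduleB sW); first exact: KW.
    exact: (submoduleZ _ sW).
  move: Kt tn0; rewrite c0 add0r => -[b bE] tn0.
  have [d dE] : exists d, d * a = 1.
    apply: (unit_of_notin lA) => ma; apply: tn0.
    by rewrite -lin_scale ms // linear0.
  exists (d * b); apply: ii.
  by rewrite -[i s]scale1r -dE -scalerA bE lin_scale e'E scalerA.
Qed.

End Hull.

(** * Duality for finitely generated free modules *)

Section FreeDual.
Variable A : comNzRingType.
Implicit Types U V W P Q X Y Z J I E F L M N R : lmodType A.

Section RowVectors.
Variable n : nat.
Notation L := ('rV[A]_n : lmodType A).

Lemma coord_linear (j : 'I_n) : linear (fun x : L => x 0 j : A^o).
Proof. by move=> a x y; rewrite !mxE. Qed.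
Definition coord j : dual L := to_hom (mklin (coord_linear j)).

Lemma lin_row U (f : {linear L -> U}) x :
  f x = \sum_j x 0 j *: f (delta_mx 0 j).
Proof.
rewrite {1}[x]row_sum_delta linear_sum.
by apply: eq_bigr => j _; rewrite lin_scale.
Qed.

Lemma dual_rowE (l : dual L) : l = \sum_j homv l (delta_mx 0 j) *: coord j.
Proof.
apply: homP => x; rewrite (lin_row (homv l)).
have ev_lin : linear (fun h : dual L => homv h x) by [].
rewrite -[RHS]/(mklin ev_lin _) linear_sum; apply: eq_bigr => j _.
by rewrite lin_scale /= [LHS]mulrC.
Qed.

Lemma lin_dual_row U (f : {linear dual L -> U}) l :
  f l = \sum_j homv l (delta_mx 0 j) *: f (coord j).
Proof.
rewrite {1}[l]dual_rowE linear_sum.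
by apply: eq_bigr => j _; rewrite lin_scale.
Qed.

Lemma dual_row_iso : exists e : {linear L -> dual L}, bijlin e.
Proof.
have le : linear (fun x : L => \sum_j x 0 j *: coord j).
  move=> a x y; rewrite scaler_sumr -big_split /=.
  by apply: eq_bigr => j _; rewrite !mxE scalerDl scalerA.
exists (mklin le); split=> [|l]; last first.
  exists (\row_j homv l (delta_mx 0 j)); rewrite [RHS]dual_rowE /=.
  by apply: eq_bigr => j _; rewrite mxE.
apply/lin_inj0 => x x0; apply/rowP => k; rewrite mxE.
have ev_lin : linear (fun h : dual L => homv h (delta_mx 0 k)) by [].
rewrite -[RHS]/(mklin ev_lin 0) -x0 -[RHS]/(mklin ev_lin _) linear_sum.
rewrite (bigD1 k) // big1 => [|j jk].
  rewrite [RHS]addr0 -[RHS]/(x 0 k * (delta_mx 0 k : L) 0 k) mxE !eqxx.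
  by rewrite mulr1.
rewrite -[LHS]/(x 0 j * (delta_mx 0 k : L) 0 j) mxE eqxx.
by rewrite (negPf jk) mulr0.
Qed.

Lemma row_reflexive : bijective (@biduality A L).
Proof.
have bl : linear (@biduality A L).
  by move=> a x y; apply: homP => l; exact: (linearP (homv l)).
suff [ib eb] : bijlin (mklin bl).
  pose s y := projT1 (cid (eb y)).
  have sE y : biduality (s y) = y by rewrite /s; case: cid.
  by exists s => [x|//]; apply: ib; rewrite [LHS]sE.
split=> [|f].
  apply/lin_inj0 => x x0; apply/rowP => k; rewrite mxE.
  by have := congr1 (fun h => homv h (coord k)) x0.
exists (\row_j homv f (coord j)); apply: homP => l.
rewrite (lin_dual_row (homv f)) /= /eval_at (lin_row (homv l)).
by apply: eq_bigr => j _; rewrite mxE [LHS]mulrC.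
Qed.

End RowVectors.

Lemma projective_iso P Q (e : {linear P -> Q}) :
  bijlin e -> projective P -> projective Q.
Proof.
move=> [ie ee] prP U V p g ep; have [ge geE] := comp_lin g e.
have [h hE] := prP _ _ p ge ep.
have [k kE] : exists k : {linear Q -> U}, forall x, k (e x) = h x.
  by apply: factor_surj => // x /(proj1 (lin_inj0 e) ie) ->; rewrite linear0.
by exists k => y; have [x <-] := ee y; rewrite kE hE geE.
Qed.

Lemma dual_row_projective n : projective (dual 'rV[A]_n).
Proof.
by have [e be] := dual_row_iso n; apply: (projective_iso be); exact: rV_projective.
Qed.

Lemma dual_fg X : noetherian A -> finite_type X -> finite_type (dual X).
Proof.
move=> nA /fg_cover[n [p ep]]; have [e [_ ee]] := dual_row_iso n.
apply: (@fg_inj _ _ _ (precomp A^o p) nA) (fg_epi ee (fg_rV A n)).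
apply/lin_inj0 => f f0; apply: homP => x; have [y <-] := ep x.
by have := congr1 (fun h => homv h y) f0.
Qed.

(** * Ext into the ring and into the character dual of an injective *)

(** The map of Hom(L, A) to E attached to l (x) e; for L free these generate
    Hom(Hom(L, A), E), which is L (x) E. *)
Lemma dtens_exists L E : exists t : {linear L -> hom E (hom (dual L) E)},
  forall l e f, homv (homv (t l) e) f = homv f l *: e.
Proof.
have l1 (l : L) (e : E) : linear (fun f : dual L => (homv f l : A) *: e).
  by move=> a f g; rewrite scalerA -scalerDl; congr (_ *: _).
have l2 (l : L) : linear (fun e : E => to_hom (mklin (l1 l e))).
  move=> a x y; apply: homP => f.
  rewrite -[RHS]/(a *: (homv f l *: x) + homv f l *: y) /=.
  by rewrite scalerDr !scalerA [homv f l * a]mulrC.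
have l3 : linear (fun l : L => to_hom (mklin (l2 l))).
  move=> a x y; apply: homP => e; apply: homP => f.
  rewrite -[RHS]/(a *: (homv f x *: e) + homv f y *: e) /=.
  by rewrite lin_hom scalerDl scalerA.
by exists (mklin l3).
Qed.

Definition dtens L E : {linear L -> hom E (hom (dual L) E)} :=
  projT1 (cid (dtens_exists L E)).

Lemma dtensE L E l e f : homv (homv (dtens L E l) e) f = homv f l *: e.
Proof. by rewrite /dtens; case: cid => t /=. Qed.

Lemma dtens_map L L' E (d : {linear L -> L'}) l e :
  precomp E (precomp A^o d) (homv (dtens L E l) e) = homv (dtens L' E (d l)) e.
Proof. by apply: homP => f; rewrite [LHS]dtensE dtensE. Qed.

Lemma dtens_ext n E W (f g : {linear hom (dual 'rV[A]_n) E -> W}) :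
  (forall l e, f (homv (dtens _ E l) e) = g (homv (dtens _ E l) e)) ->
  forall u, f u = g u.
Proof.
move=> fg u.
have -> : u = \sum_j homv (dtens 'rV[A]_n E (delta_mx 0 j)) (homv u (coord j)).
  apply: homP => l; rewrite (lin_dual_row (homv u)).
  have ev_lin : linear (fun h : hom (dual 'rV[A]_n) E => homv h l) by [].
  rewrite -[RHS]/(mklin ev_lin _) linear_sum; apply: eq_bigr => j _.
  by rewrite /= dtensE.
by rewrite !linear_sum; apply: eq_bigr => j _; apply: fg.
Qed.

Lemma dtens_lift n E W (f : {linear 'rV[A]_n -> hom E W}) :
  exists g : {linear hom (dual 'rV[A]_n) E -> W},
    forall l e, g (homv (dtens _ E l) e) = homv (f l) e.
Proof.
have lg : linear (fun u : hom (dual 'rV[A]_n) E =>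
    \sum_j homv (f (delta_mx 0 j)) (homv u (coord j))).
  move=> a u v; rewrite scaler_sumr -big_split /=.
  by apply: eq_bigr => j _; rewrite -lin_hom.
exists (mklin lg) => l e /=.
rewrite [in RHS](lin_row f).
have ev_lin : linear (fun h : hom E W => homv h e) by [].
rewrite -[RHS]/(mklin ev_lin _) linear_sum; apply: eq_bigr => j _.
by rewrite dtensE /= (lin_scale (homv (f _))).
Qed.

Section Presentation.
Variables (n2 n1 n0 : nat) (Z : lmodType A).
Notation L2 := ('rV[A]_n2 : lmodType A).
Notation L1 := ('rV[A]_n1 : lmodType A).
Notation L0 := ('rV[A]_n0 : lmodType A).
Variables (r : {linear L2 -> L1}) (q : {linear L1 -> L0}) (p : {linear L0 -> Z}).
Hypotheses (ep : epi p) (qp : exact q p) (rq : exact r q).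

(** For L finitely generated and free, Hom(L, cdual E) is the character dual of
    Hom(Hom(L, A), E). Both Hom(-, E) and the character dual are exact, so
    exactness of Hom(L, A) gives exactness of Hom(L, cdual E). *)
Lemma ext_ring_dual E : injective_module E ->
  ExtV 0 Z A^o -> ExtV 0 Z (cdual E).
Proof.
move=> injE HA.
have {}HA := (Ext1_presentation _ ep qp rq (@rV_projective A n0)).1 HA.
apply/(Ext1_presentation _ ep qp rq (@rV_projective A n0)) => f fr.
have [F FE] := dtens_lift f.
have [|G GE] := @inj_factor _ _ _ _ (precomp E (precomp A^o q)) F
    (@chars_injective A).
  move=> u u0.
  have [|v vE] := @inj_factor _ _ _ _ (precomp A^o r) (homv u) injE.
    move=> l l0; have [|k kE] := HA (homv l).
      by move=> z; have := congr1 (fun h => homv h z) l0.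
    have -> : l = precomp A^o q (to_hom k).
      by apply: homP => x; rewrite /= kE.
    by have := congr1 (fun h => homv h (to_hom k)) u0.
  have -> : u = precomp E (precomp A^o r) (to_hom v).
    by apply: homP => l; rewrite -vE.
  have [Fr FrE] := comp_lin F (precomp E (precomp A^o r)).
  rewrite -FrE -[RHS]/((\0 : {linear _ -> chars A}) (to_hom v)).
  move: (to_hom v); apply: dtens_ext => l e.
  by rewrite FrE /= dtens_map FE fr.
have lg : linear (fun l : L0 => to_hom (mklin (linearP (G \o homv (dtens L0 E l))))).
  by move=> a x y; apply: homP => e /=; rewrite linearP /= linearP.
exists (mklin lg) => l; apply: homP => e.
by rewrite /= -dtens_map GE FE.
Qed.

(** Suppose that l is a cocycle in the dual of L1 but not a coboundary. The
    scalars that make it a coboundary form a proper ideal, contained in m, which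
    kills e; so there is a map u from the dual of L1 to E that kills the
    coboundaries and sends l to e. By exactness u factors through the dual of L2,
    where the cocycle l becomes zero, so that e = 0. *)
Lemma ext_dual_ring E (m : set A) e : local_ring m -> injective_module E ->
  e <> 0 -> (forall a, m a -> a *: e = 0 :> E) ->
  ExtV 0 Z (cdual E) -> ExtV 0 Z A^o.
Proof.
move=> lA injE en0 me HE.
have {}HE := (Ext1_presentation _ ep qp rq (@rV_projective A n0)).1 HE.
apply/(Ext1_presentation _ ep qp rq (@rV_projective A n0)) => f fr.
apply: contrapT => nf; pose l : dual L1 := to_hom f.
have [C [c [_ cE]]] := cokernel (precomp A^o q).
have lf : linear ((fun a => a *: c l) : A^o -> C).
  by move=> a x y; rewrite scalerDl scalerA.
have lg : linear ((fun a => a *: e) : A^o -> E).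
  by move=> a x y; rewrite scalerDl scalerA.
have [|h hE] := @inj_factor _ _ _ _ (mklin lf) (mklin lg) injE.
  move=> a /= al; apply: me; apply: contrapT => /(unit_of_notin lA)[b ba].
  have /cE[k kE] : c l = 0.
    by rewrite -[c l]scale1r -ba -scalerA al scaler0.
  apply: nf; exists (homv k) => x.
  by have := congr1 (fun h => homv h x) kE.
have [u uE] := comp_lin h c.
have [v vE] : exists v, precomp E (precomp A^o r) v = to_hom u.
  apply: (@chars_exact _ _ _ _ _ (precomp E (precomp A^o q))) => [k kr|]; last first.
    apply: homP => t; rewrite /= uE (_ : c _ = 0) ?linear0 //.
    by apply/cE; exists t.
  have lk : linear (fun x : L1 => to_hom (mklin (linearP (k \o homv (dtens L1 E x))))).
    by move=> a x y; apply: homP => e' /=; rewrite linearP /= linearP.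
  have [|g gE] := HE (mklin lk).
    by move=> z; apply: homP => e'; rewrite /= -dtens_map kr.
  have [G GE] := dtens_lift g; exists G => w.
  have [Gq GqE] := comp_lin G (precomp E (precomp A^o q)).
  rewrite -GqE; move: w; apply: dtens_ext => x e'.
  by rewrite GqE /= dtens_map GE gE.
apply: en0; have := hE 1; rewrite /= !scale1r => <-.
rewrite -uE -[LHS]/(homv (to_hom u) l) -vE /=.
rewrite (_ : precomp _ _ _ = 0) ?linear0 //.
by apply: homP => z; rewrite /= fr.
Qed.

End Presentation.

Lemma fg_presentation Z : noetherian A -> finite_type Z ->
  exists n2 n1 n0 (r : {linear 'rV[A]_n2 -> 'rV[A]_n1})
    (q : {linear 'rV[A]_n1 -> 'rV[A]_n0}) (p : {linear 'rV[A]_n0 -> Z}),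
  [/\ epi p, exact q p & exact r q].
Proof.
move=> nA fZ; have [n0 [U [i [p [[ii ep ip] fU]]]]] := fg_ses nA fZ.
have [n1 [U1 [i1 [p1 [[ii1 ep1 ip1] fU1]]]]] := fg_ses nA fU.
have [n2 [p2 ep2]] := fg_cover fU1.
have [q qE] := comp_lin i p1; have [r rE] := comp_lin i1 p2.
exists n2, n1, n0, r, q, p; split=> // [x|x].
  rewrite ip; split=> [[u <-]|[y <-]]; last by exists (p1 y).
  by have [y <-] := ep1 u; exists y.
rewrite qE; split=> [/(proj1 (lin_inj0 i) ii)/ip1[u <-]|[y <-]].
  by have [y <-] := ep2 u; exists y.
rewrite rE (_ : p1 _ = 0) ?linear0 //; apply/ip1; by exists (p2 y).
Qed.

Lemma Ext_ring_dual i X E : noetherian A -> finite_type X ->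
  injective_module E -> ExtV i X A^o -> ExtV i X (cdual E).
Proof.
move=> nA fX injE; have [Z [fZ ZE]] := fg_syzygy i nA fX.
rewrite /ExtV !ZE.
have [n2 [n1 [n0 [r [q [p [ep qp rq]]]]]]] := fg_presentation nA fZ.
exact: (ext_ring_dual ep qp rq).
Qed.

Lemma Ext_dual_ring i X E (m : set A) e : noetherian_local m -> finite_type X ->
  injective_module E -> e <> 0 -> (forall a, m a -> a *: e = 0 :> E) ->
  ExtV i X (cdual E) -> ExtV i X A^o.
Proof.
move=> [nA lA] fX injE e0 me; have [Z [fZ ZE]] := fg_syzygy i nA fX.
rewrite /ExtV !ZE.
have [n2 [n1 [n0 [r [q [p [ep qp rq]]]]]]] := fg_presentation nA fZ.
exact: (ext_dual_ring ep qp rq lA injE e0 me).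
Qed.

End FreeDual.

(** * Gorenstein dimension over a Gorenstein ring *)

Section Splicing.
Variable A : comNzRingType.
Implicit Types U V W P Q X Y Z J I E F L M N R : lmodType A.

Lemma zero_lmod : is_zero ('rV[A]_0 : lmodType A).
Proof. by move=> x; apply/rowP => -[]. Qed.

Section SpliceRes.
Variables (N N' F : lmodType A) (i : {linear N' -> F}) (p : {linear F -> N}).
Hypothesis ip : ses i p.
Variable G : resolution N'.

Definition splice_obj k : lmodType A := if k is j.+1 then G j else F.
Definition splice_d k : {linear splice_obj k.+1 -> splice_obj k} :=
  match k return {linear splice_obj k.+1 -> splice_obj k} with
  | 0 => mklin (linearP (i \o res_aug G))
  | j.+1 => res_d G j
  end.

Lemma splice_exact0 : exact (splice_d 0) p.
Proof.
have [ii _ ipe] := ip; move=> y; rewrite ipe; split=> [[x <-]|[x <-]].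
  by have [z <-] := res_aug_surj G x; exists z.
by exists (res_aug G x).
Qed.

Lemma splice_exactS k : exact (splice_d k.+1) (splice_d k).
Proof.
have [ii _ ipe] := ip; case: k => [|k] y; last exact: res_exactS.
rewrite -(@res_exact0 _ _ G y) /=; split=> [/(proj1 (lin_inj0 i) ii)//|->].
exact: linear0.
Qed.

Lemma splice_surj : forall x : N, exists y, p y = x.
Proof. by case: ip. Qed.

Definition splice : resolution N :=
  @Resolution A N splice_obj splice_d p splice_surj splice_exact0 splice_exactS.
End SpliceRes.

Lemma has_res_resolution (P : lmodType A -> Prop) n N : has_res P n N ->
  exists F : resolution N, (forall i, (i <= n)%N -> P (F i)) /\
    (forall i, (n < i)%N -> is_zero (F i)).
Proof.
elim: n N => [|n IHn] N /=; last first.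
  move=> [N' [F [i [p [ip PF /IHn[G [PG G0]]]]]]].
  exists (splice ip G).
  by split=> -[|k] //= nk; [exact: PG|exact: G0].
move=> [F [e [[ie ee] PF]]].
pose obj k : lmodType A := if k is _.+1 then 'rV[A]_0 else F.
pose d k : {linear obj k.+1 -> obj k} := \0.
have ex0 : exact (d 0) e.
  move=> y; split=> [/(proj1 (lin_inj0 e) ie)->|[x <-]]; last exact: linear0.
  by exists 0; rewrite linear0.
have exS k : exact (d k.+1) (d k).
  move=> y; split=> // _; exists 0; rewrite linear0; apply/esym.
  exact: zero_lmod.
exists (@Resolution A N obj d e ee ex0 exS).
by split=> -[|k] //= _; exact: zero_lmod.
Qed.

Section SpliceCores.
Variables (W J W' : lmodType A) (i : {linear W -> J}) (p : {linear J -> W'}).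
Hypothesis ip : ses i p.
Variable G : coresolution W'.

Definition cosplice_obj k : lmodType A := if k is j.+1 then G j else J.
Definition cosplice_d k : {linear cosplice_obj k -> cosplice_obj k.+1} :=
  match k return {linear cosplice_obj k -> cosplice_obj k.+1} with
  | 0 => mklin (linearP (cores_aug G \o p))
  | j.+1 => cores_d G j
  end.

Lemma cosplice_exact0 : exact i (cosplice_d 0).
Proof.
have [_ _ ipe] := ip; move=> y; rewrite -ipe /=.
split=> [|->]; last exact: linear0.
exact: (proj1 (lin_inj0 (cores_aug G)) (@cores_aug_inj _ _ G)).
Qed.

Lemma cosplice_exactS k : exact (cosplice_d k) (cosplice_d k.+1).
Proof.
have [_ ep _] := ip; case: k => [|k] y; last exact: cores_exactS.
rewrite (@cores_exact0 _ _ G y) /=; split=> [[w <-]|[x <-]].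
  by have [x <-] := ep w; exists x.
by exists (p x).
Qed.

Lemma cosplice_inj : injective i.
Proof. by case: ip. Qed.

Definition cosplice : coresolution W :=
  @Coresolution A W cosplice_obj cosplice_d i cosplice_inj cosplice_exact0
    cosplice_exactS.
End SpliceCores.

Fixpoint has_cores (P : lmodType A -> Prop) n W : Prop :=
  if n is k.+1 then
    exists W' J (i : {linear W -> J}) (p : {linear J -> W'}),
      [/\ ses i p, P J & has_cores P k W']
  else exists J (e : {linear W -> J}), bijlin e /\ P J.

Lemma has_cores_coresolution (P : lmodType A -> Prop) n W : has_cores P n W ->
  exists F : coresolution W, (forall i, (i <= n)%N -> P (F i)) /\
    (forall i, (n < i)%N -> is_zero (F i)).
Proof.
elim: n W => [|n IHn] W /=; last first.
  move=> [W' [J [i [p [ip PJ /IHn[G [PG G0]]]]]]].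
  exists (cosplice ip G).
  by split=> -[|k] //= nk; [exact: PG|exact: G0].
move=> [J [e [[ie ee] PJ]]].
pose obj k : lmodType A := if k is _.+1 then 'rV[A]_0 else J.
pose d k : {linear obj k -> obj k.+1} := \0.
have ex0 : exact e (d 0) by move=> y.
have exS k : exact (d k) (d k.+1).
  move=> y; split=> // _; exists 0; rewrite linear0; apply/esym.
  exact: zero_lmod.
exists (@Coresolution A W obj d e ie ex0 exS).
by split=> -[|k] //= _; exact: zero_lmod.
Qed.

Lemma coresolution_has_cores (P : lmodType A -> Prop) n W (F : coresolution W) :
  (forall i, (i <= n)%N -> P (F i)) -> (forall i, (n < i)%N -> is_zero (F i)) ->
  has_cores P n W.
Proof.
elim: n W F => [|n IHn] W F PF F0 /=.
  exists (F 0), (cores_aug F); split; last exact: PF.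
  split=> [|y]; first exact: (@cores_aug_inj _ _ F).
  by apply/(@cores_exact0 _ _ F); apply: (F0 1).
have [C [p [ep pe]]] := cokernel (cores_aug F).
have [d dE] : exists d : {linear C -> F 1}, forall x, d (p x) = cores_d F 0 x.
  by apply: factor_surj => // x /pe/(@cores_exact0 _ _ F).
have dinj : injective d.
  apply/lin_inj0 => y; have [x <-] := ep y.
  by rewrite dE => /(@cores_exact0 _ _ F)/pe.
have dex : exact d (cores_d F 1).
  move=> y; rewrite (@cores_exactS _ _ F 0 y).
  split=> [[x <-]|[z <-]]; first by exists (p x).
  by have [x <-] := ep z; exists x.
exists C, (F 0), (cores_aug F), p; split.
- by split=> //; exact: (@cores_aug_inj _ _ F).
- exact: PF.
apply: (IHn C (@Coresolution A C (fun i => F i.+1) (fun i => cores_d F i.+1) d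
  dinj dex (fun i => @cores_exactS _ _ F i.+1))) => i ni; first exact: PF.
exact: F0.
Qed.

Lemma inj_dim_Ext W : finite_inj_dim W ->
  exists n, forall V i, (n <= i)%N -> ExtV i V W.
Proof.
move=> [n [F [PF F0]]]; exists n; have := coresolution_has_cores PF F0.
elim: n W {F PF F0} => [|n IHn] W /=; last first.
  move=> [W' [J [i [p [ip injJ /IHn H]]]]] V [//|k] nk.
  by apply/(Ext_shiftJ _ _ ip injJ)/H.
move=> [J [e [[ie ee] injJ]]] V k _; apply: Ext_injective => U U' j g ij.
have [eg egE] := comp_lin e g; have [h hE] := injJ _ _ j eg ij.
have [k' k'E] : exists k' : {linear U' -> W}, forall x, e (k' x) = h x.
  by apply: corestrict.
by exists k' => u; apply: ie; rewrite k'E hE egE.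
Qed.

Lemma Gdim_Ext M : finite_Gdim M ->
  exists n, forall i, (n <= i)%N -> ExtV i M A^o.
Proof.
move=> [n [F [PF F0]]]; exists n; have := resolution_has_res PF F0.
have GE X i : Gdim_eq0 X -> ExtV i X A^o.
  by move=> [_ _ H _]; apply/Ext_vanish/H.
elim: n M {F PF F0} => [|n IHn] M /=.
  move=> [F [e [[ie ee] GF]]] i _.
  by rewrite /ExtV -(xExt_iso 0 i A^o ie ee); apply: GE.
move=> [N' [F [j [p [jp GF /IHn HN']]]]] [//|i] ni.
by apply: (Ext_coker jp); [apply: HN'|apply: GE].
Qed.

End Splicing.

Section Gorenstein.
Variable A : comNzRingType.
Hypothesis nA : noetherian A.
Variable n : nat.
Hypothesis ExtA : forall (V : lmodType A) i, (n <= i)%N -> ExtV i V A^o.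
Implicit Types X F : lmodType A.

(** When A is Gorenstein these turn out to be the modules of Gorenstein dimension
    zero. *)
Definition ext_free X := finite_type X /\ forall i, ExtV i X A^o.

Lemma ext_free_row k : ext_free 'rV[A]_k.
Proof.
split; first exact: fg_rV.
by move=> i; apply: Ext_projective; exact: rV_projective.
Qed.

Lemma ext_free_ses X : ext_free X ->
  exists k X' (i : {linear X' -> 'rV[A]_k}) (p : {linear 'rV[A]_k -> X}),
    [/\ ses i p, ext_free X' & ses (precomp A^o p) (precomp A^o i)].
Proof.
move=> [fX EX]; have [k [X' [i [p [ip fX']]]]] := fg_ses nA fX.
exists k, X', i, p; split=> //.
  split=> // l; apply/(Ext_shiftP _ _ ip (@rV_projective A k)); exact: EX.
have [ii ep ipe] := ip; split.
- move=> f g fg; apply: homP => w; have [v <-] := ep w.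
  by have := congr1 (fun h => homv h v) fg.
- move=> f; have [g gE] := Ext1_extend ip (EX 0) (homv f).
  by exists (to_hom g); apply: homP.
- move=> f; split=> [f0|[g <-]].
    have [g gE] : exists g : {linear X -> A^o}, forall v, g (p v) = homv f v.
      by apply: (ses_out ip) => u; have := congr1 (fun h => homv h u) f0.
    by exists (to_hom g); apply: homP.
  by apply: homP => u; rewrite /= (ses_comp0 ip) linear0.
Qed.

(** Dualizing 0 -> X' -> F -> X -> 0 makes X* a syzygy of X'*, and repeating
    this makes X* an n-th syzygy. *)
Lemma ext_free_dual X : ext_free X -> ext_free (dual X).
Proof.
suff H j i X' : ext_free X' -> (n <= i + j)%N -> ExtV i (dual X') A^o.
  move=> GX; split; first exact: (dual_fg nA GX.1).
  by move=> i; apply: (H n) => //; rewrite leq_addl.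
elim: j i X' {X} => [|j IHj] i X GX nij.
  by apply: ExtA; rewrite addn0 in nij.
have [k [X' [q [p [qp GX' dqp]]]]] := ext_free_ses GX.
apply/(Ext_shiftP _ _ dqp (@dual_row_projective A k)).
by apply: IHj; rewrite // addSnnS.
Qed.

Lemma biduality_linear X : linear (@biduality A X).
Proof. by move=> a x y; apply: homP => l; exact: (linearP (homv l)). Qed.

(** A form on the dual of X extends to a form on the dual of F, since Ext^1 of
    the dual of X' vanishes, and the latter form is evaluation at a point. *)
Lemma biduality_epi X : ext_free X -> epi (@biduality A X).
Proof.
move=> GX f; have [k [X' [q [p [qp GX' dqp]]]]] := ext_free_ses GX.
have [_ EX'] := ext_free_dual GX'.
have [g gE] := Ext1_extend dqp (EX' 0) (homv f).
have [b _ bK] := row_reflexive A k.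
exists (p (b (to_hom g))); apply: homP => l; rewrite -gE.
by have := congr1 (fun h => homv h (precomp A^o p l)) (bK (to_hom g)).
Qed.

(** Injectivity for X follows from surjectivity for X'. If f in F lifts an
    element of X killed by all forms, evaluation at f factors through the dual of
    X', hence is evaluation at a point of X', and f lies in X'. *)
Lemma ext_free_reflexive X : ext_free X -> bijective (@biduality A X).
Proof.
move=> GX; have eb := biduality_epi GX.
suff ib : injective (@biduality A X).
  pose s y := projT1 (cid (eb y)).
  have sE y : biduality (s y) = y by rewrite /s; case: cid.
  by exists s => // x; apply: ib; rewrite sE.
suff /lin_inj0 : forall x, mklin (@biduality_linear X) x = 0 -> x = 0 by [].
move=> x x0; have [k [X' [q [p [qp GX' dqp]]]]] := ext_free_ses GX.
have [iq ep qpe] := qp; have [_ edq edqe] := dqp; have [f fx] := ep x.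
have [b bK _] := row_reflexive A k.
have [g gE] : exists g : {linear dual X' -> A^o}, forall l, 
    g (precomp A^o q l) = homv (biduality f) l.
  apply: (ses_out dqp) => l; rewrite /= /eval_at /= fx.
  by have := congr1 (fun h => homv h l) x0.
have [x' x'E] := biduality_epi GX' (to_hom g).
suff fE : f = q x' by rewrite -fx fE (ses_comp0 qp).
apply: (can_inj bK); apply: homP => l; rewrite -gE.
by have := congr1 (fun h => homv h (precomp A^o q l)) x'E.
Qed.

Lemma ext_free_Gdim0 X : ext_free X -> Gdim_eq0 X.
Proof.
move=> GX; have [fX EX] := GX; have [_ EdX] := ext_free_dual GX; split=> //.
- exact: ext_free_reflexive.
- by case=> // i _; apply/Ext_vanish.
- by case=> // i _; apply/Ext_vanish.
Qed.

Lemma fg_finite_Gdim (M : lmodType A) : finite_type M -> finite_Gdim M.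
Proof.
move=> fM; suff H j (X : lmodType A) : finite_type X ->
    (forall i, (j <= i)%N -> ExtV i X A^o) -> has_res (@Gdim_eq0 A) j X.
  have /has_res_resolution[T TE] := H n M fM (@ExtA M).
  by exists n, T.
elim: j X {M fM} => [|j IHj] X fX EX /=.
  exists X, (mklin (linearP (idfun : {linear X -> X}))).
  split; first by split=> [x y|y] //=; exists y.
  by apply: ext_free_Gdim0; split=> // i; apply: EX.
have [k [X' [q [p [qp fX']]]]] := fg_ses nA fX.
exists X', 'rV[A]_k, q, p; split=> //.
  exact/ext_free_Gdim0/ext_free_row.
apply: IHj => // i ji; apply/(Ext_shiftP _ _ qp (@rV_projective A k)).
exact: EX.
Qed.

End Gorenstein.

Lemma gorenstein_finite_Gdim (A : comNzRingType) (M : lmodType A) :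
  gorenstein A -> finite_type M -> finite_Gdim M.
Proof.
by move=> [nA _ /inj_dim_Ext[n EA]]; apply: (fg_finite_Gdim nA EA).
Qed.

(** * Koszul complexes *)

Section Koszul.
Variable A : comNzRingType.
Implicit Types U V W E : lmodType A.

Record complex := Complex {
  cobj :> nat -> lmodType A;
  cd : forall i, {linear cobj i.+1 -> cobj i};
  cdd : forall i x, cd i (cd i.+1 x) = 0
}.

(** Position i - 1 of a complex, with zero in position -1: this lets the
    statements below be uniform in the position. *)
Definition prev (C : nat -> lmodType A) i : lmodType A :=
  if i is j.+1 then C j else 'rV[A]_0.
Definition pd (C : complex) i : {linear C i -> prev C i} :=
  match i return {linear C i -> prev C i} with 0 => \0 | j.+1 => cd C j end.

Lemma pd_cd (C : complex) i x : pd C i (cd C i x) = 0.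
Proof. by case: i x => [|i] x //=; exact: cdd. Qed.

Lemma prev0 (C : nat -> lmodType A) (x : prev C 0) : x = 0.
Proof. exact: zero_lmod. Qed.

Section Cone.
Variables (x : A) (C : complex).

Definition cone_obj i : lmodType A := (C i * prev C i)%type.
Definition cone_fun i (z : C i.+1 * C i) : cone_obj i :=
  (cd C i z.1 + x *: z.2, - pd C i z.2).
Lemma cone_linear i : linear (@cone_fun i).
Proof.
move=> a [u v] [u' v']; rewrite /cone_fun /=; congr pair => /=.
  rewrite linearP [x *: (_ + _)]scalerDr [a *: (_ + _)]scalerDr addrACA.
  by congr (_ + _ + _); rewrite !scalerA mulrC.
by rewrite linearP opprD scalerN.
Qed.
Definition cone_d i : {linear cone_obj i.+1 -> cone_obj i} :=
  mklin (@cone_linear i).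

Lemma cone_dE i (u : C i.+1) (v : C i) :
  cone_d i (u, v) = (cd C i u + x *: v, - pd C i v).
Proof. by []. Qed.

Lemma cone_dd i z : cone_d i (cone_d i.+1 z) = 0.
Proof.
case: z => u v; rewrite [cone_d i.+1 _]cone_dE [cone_d i _]cone_dE.
congr pair; last by rewrite linearN pd_cd !oppr0.
by rewrite linearD cdd lin_scale add0r scalerN subrr.
Qed.

(** The mapping cone of multiplication by x. *)
Definition cone : complex := Complex cone_dd.

End Cone.

Fixpoint koszul (xs : seq A) (C : complex) : complex :=
  if xs is x :: s then cone x (koszul s C) else C.

Definition cexact (C : complex) i : Prop :=
  forall a : C i, pd C i a = 0 -> exists c, cd C i c = a.

Definition chain_map (C D : complex) (f : forall i, {linear C i -> D i}) : Prop :=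
  forall i c, f i (cd C i c) = cd D i (f i.+1 c).

(** Surjective quasi-isomorphisms, stated through the exactness of the kernel
    because that passes to cones at once. *)
Definition racyclic (C D : complex) : Prop :=
  exists f : forall i, {linear C i -> D i},
  [/\ chain_map f, forall i, epi (f i) &
    forall i (a : C i), f i a = 0 -> pd C i a = 0 ->
      exists c, f i.+1 c = 0 /\ cd C i c = a].

Lemma racyclic_cone x C D : racyclic C D -> racyclic (cone x C) (cone x D).
Proof.
move=> [f [fd fe fk]].
pose pf i : {linear prev C i -> prev D i} :=
  match i return {linear prev C i -> prev D i} with 0 => \0 | j.+1 => f j end.
have pfd i c : pf i (pd C i c) = pd D i (f i c).
  by case: i c => [|i] c /=; rewrite ?fd // linear0.
have lf i : linear (fun z : cone x C i => (f i z.1, pf i z.2) : cone x D i).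
  by move=> a u v; congr pair; rewrite /= linearP.
exists (fun i => mklin (lf i)); split.
- move=> i [u v]; rewrite [cd (cone x C) i _]cone_dE [RHS]cone_dE.
  by congr pair => /=; rewrite ?linearD ?fd ?(lin_scale (f i)) // linearN pfd.
- move=> i [u v]; have [u' <-] := fe i u.
  case: i u u' v => [|i] u u' v; last first.
    by have [v' <-] := fe i v; exists (u', v').
  by exists (u', 0); congr pair; rewrite [LHS]prev0 [RHS]prev0.
- move=> i [a b] [fa fb] dab.
  have [e [fe0 eb ea]] : exists e : C i, [/\ f i e = 0, - pd C i e = b &
      pd C i (a - x *: e) = 0].
    case: i a b fa fb dab => [|i] a b fa fb dab.
      exists 0; split; [exact: linear0| |exact: prev0].
      by rewrite [LHS]prev0 [RHS]prev0.
    move: dab; rewrite [pd (cone x C) i.+1 _]cone_dE => -[da /eqP].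
    rewrite oppr_eq0 => /eqP db; have [c [fc cb]] := fk i b fb db.
    exists (- c); split; first by rewrite linearN fc oppr0.
      by rewrite /= linearN cb opprK.
    by rewrite scalerN opprK /= linearD (lin_scale (cd C i)) cb.
  have [|c [fc cE]] := fk i (a - x *: e) _ ea.
    by rewrite linearB (lin_scale (f i)) fe0 fa scaler0 subr0.
  exists (c, e); split; first by congr pair => /=.
  by rewrite [LHS]cone_dE cE eb subrK.
Qed.

Lemma racyclic_koszul xs C D :
  racyclic C D -> racyclic (koszul xs C) (koszul xs D).
Proof. by move=> CD; elim: xs => //= x xs; apply: racyclic_cone. Qed.

Lemma koszul_bounded xs (C : complex) n : (forall i, (n <= i)%N -> is_zero (C i)) ->
  forall i, (size xs + n <= i)%N -> is_zero (koszul xs C i).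
Proof.
move=> C0; elim: xs => //= x xs IH [//|i] ni [u v].
by rewrite (IH i.+1 _ u) ?(IH i _ v) //; apply: leqW.
Qed.

Lemma koszul_projective xs (C : complex) : (forall i, projective (C i)) ->
  forall i, projective (koszul xs C i).
Proof.
move=> prC; elim: xs => //= x xs IH i; apply: prod_projective; first exact: IH.
by case: i => [|i]; [exact: rV_projective|exact: IH].
Qed.

Definition pds (C : complex) (s : forall i, {linear C i -> C i.+1}) i :
    {linear prev C i -> C i} :=
  match i return {linear prev C i -> C i} with 0 => \0 | j.+1 => s j end.

Definition null_homotopic (y : A) (C : complex) : Prop :=
  exists s : forall i, {linear C i -> C i.+1},
    forall i (a : C i), cd C i (s i a) + pds s i (pd C i a) = y *: a.

Lemma null_homotopic_cone x y C : null_homotopic y C -> null_homotopic y (cone x C).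
Proof.
move=> [s sE].
have ls i : linear (fun z : cone x C i =>
    (s i z.1, - pds s i z.2) : cone x C i.+1).
  move=> a u v; congr pair; rewrite /= linearP //.
  by rewrite opprD scalerN.
exists (fun i => mklin (ls i)) => i [a b].
rewrite -[mklin _ _]/(s i a, - pds s i b) [cd (cone x C) i _]cone_dE [pd C i (- _)]linearN scalerN opprK.
case: i a b => [|i] a b.
  congr pair; last by rewrite [LHS]prev0 [RHS]prev0.
  by rewrite -[RHS](sE 0 a) /= scaler0 subr0.
rewrite [pd (cone x C) i.+1 _]cone_dE [pds _ _ _]/=; congr pair => /=.
  rewrite linearD (lin_scale (s i)) addrACA addNr addr0.
  exact: (sE i.+1 a).
by rewrite linearN opprK; exact: (sE i b).
Qed.

(** The homotopy sends the summand C i identically to the same summand one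
    degree higher. *)
Lemma null_homotopic_cone_self x C : null_homotopic x (cone x C).
Proof.
have ls i : linear (fun z : cone x C i => (0, z.1) : cone x C i.+1).
  by move=> a u v; congr pair; rewrite /= scaler0 addr0.
exists (fun i => mklin (ls i)) => i [a b].
rewrite [cd (cone x C) i _]cone_dE linear0 add0r.
case: i a b => [|i] a b.
  rewrite [pds _ 0 _]/= addr0 [b]prev0.
  by congr pair; rewrite [RHS]prev0 [LHS]prev0.
rewrite [pd (cone x C) i.+1 _]cone_dE [pds _ _ _]/=; congr pair => /=.
  by rewrite addr0.
by rewrite addKr.
Qed.

Lemma null_homotopic_koszul xs C x : x \in xs -> null_homotopic x (koszul xs C).
Proof.
elim: xs => //= y xs IH; rewrite inE => /predU1P[->|/IH].
  exact: null_homotopic_cone_self.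
exact: null_homotopic_cone.
Qed.

(** Koszul complexes on E have this form by self-duality; it lets cycles and
    boundaries be compared through the finitely generated modules G i. *)
Definition hom_complex E (C : complex) : Prop :=
  exists (G : nat -> lmodType A) (g : forall i, {linear G i -> G i.+1})
    (t : forall i, {linear C i -> hom (G i) E}),
  [/\ forall i, finite_type (G i), forall i, bijlin (t i) &
    forall i c u, homv (t i (cd C i c)) u = homv (t i.+1 c) (g i u)].

Lemma fg_prod U V : finite_type U -> finite_type V -> finite_type (U * V)%type.
Proof.
move=> /finite_typeP[s sU] /finite_typeP[t tV]; apply/finite_typeP.
exists ([seq (u, 0) | u <- s] ++ [seq (0, v) | v <- t]) => -[x y].
have l1 : linear (fun u : U => (u, 0) : U * V).
  by move=> a u v; congr pair; rewrite /= scaler0 addr0.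
have l2 : linear (fun v : V => (0, v) : U * V).
  by move=> a u v; congr pair; rewrite /= scaler0 addr0.
have sl := submodule_lspan ([seq (u, 0 : V) | u <- s] ++ [seq (0 : U, v) | v <- t]).
have -> : (x, y) = (x, 0) + (0, y) :> U * V by congr pair; rewrite /= ?addr0 ?add0r.
apply: (submoduleD sl).
  apply: (lspan_sub (submodule_preim (mklin l1) sl)) (sU x) => z zs.
  by apply: lspan_mem; rewrite mem_cat map_f.
apply: (lspan_sub (submodule_preim (mklin l2) sl)) (tV y) => z zs.
by apply: lspan_mem; rewrite mem_cat orbC map_f.
Qed.

Lemma hom_complex_cone E x C : hom_complex E C -> hom_complex E (cone x C).
Proof.
move=> [G [g [t [fG bt tg]]]].
pose pg i : {linear prev G i -> G i} :=
  match i return {linear prev G i -> G i} with 0 => \0 | j.+1 => g j end.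
pose pt i : {linear prev C i -> hom (prev G i) E} :=
  match i return {linear prev C i -> hom (prev G i) E} with
  | 0 => \0 | j.+1 => t j end.
have ptg i (b : C i) v : homv (pt i (pd C i b)) v = homv (t i b) (pg i v).
  by case: i b v => [|i] b v; [rewrite /= linear0|exact: tg].
have lh i (z : cone x C i) :
    linear (fun w : G i * prev G i => homv (t i z.1) w.1 + homv (pt i z.2) w.2).
  by move=> a u v; rewrite !lin_hom scalerDr addrACA.
have lt i : linear (fun z => to_hom (mklin (lh i z))).
  move=> a u v; apply: homP => w /=; rewrite !linearP.
  by rewrite -[RHS]/(a *: (_ + _) + (_ + _)) scalerDr addrACA.
have lg i : linear (fun w : G i * prev G i =>
    (g i w.1, x *: w.1 - pg i w.2) : G i.+1 * G i).
  move=> a u v; congr pair; rewrite /= linearP //.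
  rewrite opprD scalerBr !scalerDr addrACA !scalerA [x * a]mulrC.
  by [].
exists (fun i => (G i * prev G i)%type), (fun i => mklin (lg i)),
  (fun i => mklin (lt i)); split.
- move=> i; apply: fg_prod => //; case: i => [|i]; [exact: (fg_rV A 0)|exact: fG].
- move=> i; have [it et] := bt i; split.
    apply/lin_inj0 => -[a b] ab0.
    have hab u v : homv (t i a) u + homv (pt i b) v = 0.
      by have := congr1 (fun h => homv h (u, v)) ab0.
    congr pair.
      apply: it; apply: homP => u; rewrite linear0.
      by have := hab u 0; rewrite [homv _ 0]linear0 addr0.
    case: i {it et lh lt lg} a b {ab0} hab => [|i] a b hab; first exact: prev0.
    have [it _] := bt i; apply: it; apply: homP => v; rewrite linear0.
    by have := hab 0 v; rewrite [homv _ 0]linear0 add0r.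
  move=> h.
  have l1 : linear (fun u : G i => homv h (u, 0)).
    move=> a u v; rewrite -lin_hom; congr homv; congr pair.
    by rewrite /= scaler0 addr0.
  have l2 : linear (fun v : prev G i => homv h (0, v)).
    move=> a u v; rewrite -lin_hom; congr homv; congr pair.
    by rewrite /= scaler0 addr0.
  have [a aE] := et (to_hom (mklin l1)).
  have [b bE] : exists b, pt i b = to_hom (mklin l2).
    case: i {it et lh lt lg} h l1 a aE l2 => [|i] h l1 a aE l2.
      by exists 0; apply: homP => v; rewrite [v]prev0 !linear0.
    by have [_ et] := bt i; apply: et.
  exists (a, b); apply: homP => -[u v] /=; rewrite aE bE /= -linearD.
  by congr (homv h _); congr pair; rewrite /= ?addr0 ?add0r.
- move=> i [a b] [u v]; rewrite [cd (cone x C) i _]cone_dE /=.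
  rewrite linearN linearD (lin_scale (t i)).
  rewrite -[homv (_ + _) u]/(homv (t i (cd C i a)) u + x *: homv (t i b) u).
  rewrite -[homv (- _) v]/(- homv (pt i (pd C i b)) v) tg ptg -addrA.
  by rewrite linearB lin_scale.
Qed.

Lemma hom_complex_koszul E xs C :
  hom_complex E C -> hom_complex E (koszul xs C).
Proof. by move=> CE; elim: xs => //= x xs; apply: hom_complex_cone. Qed.

Definition hexact (C : complex) W i : Prop :=
  forall f : {linear C i -> W}, (forall c, f (cd C i c) = 0) ->
    exists g : {linear prev C i -> W}, forall a, f a = g (pd C i a).

(** On the cone, a cocycle is a pair of a cocycle al of degree i and a map be of
    degree i - 1 whose coboundary is x al. A primitive psi of al makes
    be - x psi a cocycle. *)
Lemma hexact_cone x (C : complex) W n : (forall i, (n <= i)%N -> hexact C W i) ->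
  forall i, (n < i)%N -> hexact (cone x C) W i.
Proof.
move=> H [//|j] nj f fd.
have l1 : linear (fun a : C j.+1 => (a, 0) : cone x C j.+1).
  by move=> a u v; congr pair; rewrite /= scaler0 addr0.
have l2 : linear (fun b : C j => (0, b) : cone x C j.+1).
  by move=> a u v; congr pair; rewrite /= scaler0 addr0.
have [al alE] := comp_lin f (mklin l1); have [be beE] := comp_lin f (mklin l2).
have fE a b : f (a, b) = al a + be b.
  by rewrite alE beE -linearD; congr (f _); congr pair; rewrite /= ?addr0 ?add0r.
have fdE a b : al (cd C j.+1 a + x *: b) - be (cd C j b) = 0.
  by have := fd (a, b); rewrite [cd (cone x C) _ _]cone_dE fE linearN.
have [|psi psiE] := H j.+1 (leqW nj) al.
  by move=> c; have := fdE c 0; rewrite scaler0 addr0 !linear0 addr0.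
have [xp xpE] := scale_lin x psi; have [be' be'E] := sub_lin be xp.
have [|chi chiE] := H j nj be'.
  move=> c; rewrite be'E xpE; have := fdE 0 c; rewrite linear0 add0r.
  rewrite (lin_scale al) psiE => /eqP; rewrite subr_eq0 => /eqP <-.
  by rewrite /= subrr.
have lg : linear (fun w : C j * prev C j => psi w.1 - chi w.2).
  by move=> a u v; rewrite (linearP psi) (linearP chi) scalerBr opprD addrACA.
exists (mklin lg) => -[a b]; rewrite [pd (cone x C) _ _]cone_dE /= fE psiE.
rewrite linearN opprK -chiE be'E xpE linearD (lin_scale psi) -addrA.
by congr (_ + _); rewrite addrC subrK.
Qed.

Lemma hexact_koszul xs (C : complex) W n : (forall i, (n <= i)%N -> hexact C W i) ->
  forall i, (size xs + n <= i)%N -> hexact (koszul xs C) W i.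
Proof.
by move=> H; elim: xs => //= x xs IH i; rewrite addSn; apply: hexact_cone.
Qed.

(** As x kills W, a cocycle f of C gives the cocycle (0, f) of the cone, and the
    second component of a primitive of (0, f) is, up to sign, one of f. *)
Lemma hexact_cone_inv x (C : complex) W i : (forall w : W, x *: w = 0) ->
  hexact (cone x C) W i.+1 -> hexact C W i.
Proof.
move=> xW H f fd.
have lF : linear (fun w : cone x C i.+1 => f w.2).
  by move=> a u v; rewrite linearP.
have [|G GE] := H (mklin lF).
  move=> [a b]; rewrite [cd (cone x C) _ _]cone_dE /= linearN fd oppr0.
  by [].
have l2 : linear (fun b : prev C i => - G (0, b)).
  move=> a u v; rewrite scalerN -opprD -linearP; congr (- G _); congr pair.
  by rewrite /= scaler0 addr0.
exists (mklin l2) => b; have := GE (0, b); rewrite [pd (cone x C) _ _]cone_dE /=.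
rewrite linear0 add0r => ->.
have -> : G (x *: b, - pd C i b) = x *: G (b, 0) - G (0, pd C i b).
  rewrite -lin_scale -linearB; congr (G _); congr pair => /=.
    by rewrite subr0.
  by rewrite scaler0 sub0r.
by rewrite xW sub0r.
Qed.

Lemma hexact_koszul_inv xs (C : complex) W n : (forall x, x \in xs -> forall w : W, x *: w = 0) ->
  (forall i, (n <= i)%N -> hexact (koszul xs C) W i) ->
  forall i, (n <= i)%N -> hexact C W i.
Proof.
elim: xs => //= x xs IH xW H; apply: IH => [y ys|i ni].
  by apply: xW; rewrite inE ys orbT.
apply: (@hexact_cone_inv x); first by apply: xW; rewrite inE eqxx.
by apply: H; apply: leqW.
Qed.

End Koszul.

(** * A finitely generated module built from the Koszul complex *)

Section Resolutions.
Variable A : comNzRingType.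
Implicit Types U V W N E Q : lmodType A.

Lemma resolution_hexact (R : complex A) N (p : {linear R 0 -> N}) W :
  (forall i, projective (R i)) -> (forall i, cexact R i.+1) ->
  epi p -> exact (cd R 0) p ->
  forall i, ExtV i N W <-> hexact R W i.+1.
Proof.
move=> prR exR ep e0 i; elim: i R N p prR exR ep e0 => [|i IHi] R N p prR exR ep e0.
  have e1 : exact (cd R 1) (cd R 0).
    move=> y; split; first exact: (exR 0).
    by move=> [x <-]; exact: cdd.
  rewrite (Ext1_presentation _ ep e0 e1 (prR 0)).
  split=> H f fd; have [g gE] := H f fd; exists g => u; exact/esym/gE.
have ks : ses (@kerv A _ _ p) p by split; [exact: kerv_inj|by []|exact: kerv_exact].
have [d dE] : exists d : {linear R 1 -> kerm p}, forall x, kerv (d x) = cd R 0 x.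
  apply: corestrict => [|x]; first exact: kerv_inj.
  by apply/kerv_exact/e0; exists x.
have R'd i' x : cd R i'.+1 (cd R i'.+2 x) = 0 by exact: cdd.
pose R' := @Complex A (fun i => R i.+1) (fun i => cd R i.+1) R'd.
rewrite (Ext_shiftP _ _ ks (prR 0)).
have -> : hexact R W i.+2 = hexact R' W i.+1 by [].
apply: (IHi R' (kerm p) d) => [j|j|z|y].
- exact: prR.
- exact: (exR j.+1).
- have /e0[x xE] := kerv0 z; exists x; apply: kerv_inj.
  by rewrite dE.
- split=> [dy|[x <-]].
    by apply: (exR 0); rewrite /= -dE dy linear0.
  by apply: kerv_inj; rewrite dE linear0; exact: cdd.
Qed.

Lemma free_res_dd V i x : free_res_d V i (free_res_d V i.+1 x) = 0.
Proof. by apply/free_res_exact; exists x. Qed.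

Definition free_complex V : complex A := Complex (@free_res_dd V).

Lemma free_complex_hexact V W i :
  ExtV i V W <-> hexact (free_complex V) W i.+1.
Proof.
apply: (@resolution_hexact (free_complex V) V (free_cover V)) => [j|j y||].
- exact: free_projective.
- by move/free_res_exact.
- exact: free_cover_surj.
- exact: (@free_cover_exact A V 0).
Qed.

Definition degree0_obj V i : lmodType A := if i is 0 then V else 'rV[A]_0.
Lemma degree0_dd V i (x : degree0_obj V i.+2) :
  (\0 : {linear degree0_obj V i.+1 -> degree0_obj V i})
    ((\0 : {linear degree0_obj V i.+2 -> degree0_obj V i.+1}) x) = 0.
Proof. by []. Qed.
Definition degree0 V : complex A :=
  @Complex A (degree0_obj V) (fun i => \0) (@degree0_dd V).

Lemma free_complex_degree0 V : racyclic (free_complex V) (degree0 V).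
Proof.
pose f i : {linear free_complex V i -> degree0 V i} :=
  match i return {linear free_complex V i -> degree0 V i} with
  | 0 => free_cover V | j.+1 => \0 end.
exists f; split.
- case=> [|i] c //=; apply/(@free_cover_exact A V 0); by exists c.
- case=> [|i] y; first exact: free_cover_surj.
  by exists 0; rewrite linear0 [RHS]zero_lmod.
- case=> [|i] a fa da.
    have [c cE] := (@free_cover_exact A V 0 a).1 fa.
    by exists c.
  have [c cE] := (@free_res_exact A V i a).1 da.
  by exists c.
Qed.

Lemma hom_complex_degree0 E : hom_complex E (degree0 E).
Proof.
pose G i : lmodType A := if i is 0 then A^o else 'rV[A]_0.
have lt (e : E) : linear ((fun a => a *: e) : A^o -> E).
  by move=> a x y; rewrite scalerDl scalerA.
have lt0 : linear (fun e : E => to_hom (mklin (lt e))).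
  move=> a x y; apply: homP => b.
  rewrite -[RHS]/(a *: (b *: x) + b *: y) /=.
  by rewrite scalerDr !scalerA [a * b]mulrC.
pose t i : {linear degree0 E i -> hom (G i) E} :=
  match i return {linear degree0 E i -> hom (G i) E} with
  | 0 => mklin lt0 | j.+1 => \0 end.
exists G, (fun i => \0), t; split.
- case=> [|i]; last exact: (fg_rV A 0).
  apply/finite_typeP; exists [:: 1] => x /=; exists x.
  by rewrite /mkset [_ *: _]mulr1 subrr.
- case=> [|i]; split.
  + apply/lin_inj0 => x x0; have := congr1 (fun h => homv h 1) x0.
    by rewrite /= scale1r.
  + move=> h; exists (homv h 1); apply: homP => a /=.
    by rewrite -(lin_scale (homv h)) [_ *: _]mulr1.
  + by apply/lin_inj0 => x _; exact: zero_lmod.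
  + move=> h; exists 0; apply: homP => a.
    by rewrite [a]zero_lmod !linear0.
- by case=> [|i] c u; rewrite ?linear0 // /= scaler0 linear0.
Qed.

Lemma racyclic_exact (C D : complex A) i :
  racyclic C D -> is_zero (D i) -> cexact C i.
Proof.
by move=> [f [_ _ fk]] D0 a da; have [c []] := fk i a (D0 _) da; exists c.
Qed.

Lemma fg_exact U V W (f : {linear U -> V}) (g : {linear V -> W}) :
  noetherian A -> exact f g -> finite_type U -> finite_type W -> finite_type V.
Proof.
move=> nA fg /finite_typeP[s sU] /finite_typeP[t tW].
have [|||v [_ vE]] := @fgset_ext _ _ _ g setT.
- by split.
- apply: (@noetherian_sub _ _ t _ nA) => //.
  split=> [|a _ _ [x _ <-] [y _ <-]]; first by exists 0; rewrite ?linear0.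
  by exists (a *: x + y); rewrite ?linearP.
- exists (map f s); split=> [_ /mapP[x _ ->]|y [_ /fg[x <-]]].
    by split=> //; apply/fg; exists x.
  apply: (lspan_sub (submodule_preim f (submodule_lspan _))) (sU x) => z zs.
  exact/lspan_mem/map_f.
by apply/finite_typeP; exists v => x; apply: vE.
Qed.

End Resolutions.

Section KoszulHomology.
Variables (A : comNzRingType) (m : set A).
Hypothesis nA : noetherian A.
Variables (E : lmodType A) (e : E).
Hypothesis injE : injective_module E.
Hypothesis socE : forall s, (forall a, m a -> a *: s = 0) -> exists b, s = b *: e.

(** A cycle of Hom(G, E) is a boundary when it vanishes on the cocycles of G,
    which form a finitely generated module. Evaluation at generators embeds the
    homology in a power of E, and where m kills the homology it lands in the
    corresponding power of the socle of E. *)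
Lemma koszul_homology_fg (C D : complex A) i :
  racyclic C D -> hom_complex E D ->
  (forall y, m y -> forall a : C i, pd C i a = 0 ->
     exists c, cd C i c = y *: a) ->
  finite_type (homology (cd C i) (pd C i)).
Proof.
move=> [f [fd fe fk]] [G [g [t [fG bt tg]]]] mC.
have [w wG] := (finite_typeP _).1 (fG i).
have [|s [sK sE]] := @noetherian_sub _ _ w [set u | g i u = 0] nA
    (submodule_ker (g i)); first by move=> u _; apply: wG.
have ev (z : C i) : pd C i z = 0 ->
    (forall u, u \in s -> homv (t i (f i z)) u = 0) ->
  exists c, cd C i c = z.
  move=> dz zs.
  have [|h hE] := @inj_factor _ _ _ _ (g i) (homv (t i (f i z))) injE.
    move=> u /sE; apply: lspan_sub zs u; exact: submodule_ker.
  have [c cE] := (bt i.+1).2 (to_hom h).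
  have [c' c'E] := fe i.+1 c.
  have fz : f i z = cd D i c.
    apply: (bt i).1; apply: homP => u; rewrite tg cE.
    by rewrite -hE.
  have [||c'' [_ c''E]] := fk i (z - cd C i c').
  - by rewrite linearB fd c'E fz subrr.
  - by rewrite linearB dz pd_cd subrr.
  by exists (c'' + c'); rewrite linearD c''E subrK.
have ev0 c u : u \in s -> homv (t i (f i (cd C i c))) u = 0.
  by move=> us; rewrite fd tg (sK u us) linear0.
pose k := size s; pose Z := kerm (pd C i).
have lT : linear (fun (z : Z) (l : 'I_k) => homv (t i (f i (kerv z))) s`_l).
  by move=> a x y; apply: funext => l; rewrite !linearP.
have [T TE] := linear_exists lT.
pose S := [set z : Z | exists u : C i.+1, cd C i u = kerv z].
have sS : submodule S.
  split=> [|a x y [u uE] [v vE]]; first by exists 0; rewrite !linear0.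
  by exists (a *: u + v); rewrite !linearP uE vE.
have [H [p [ep pE]]] := quotient_exists sS.
have TS z : T z = 0 <-> S z.
  split=> [T0|[c cE]].
    apply: ev; first exact: kerv0.
    move=> u us; have lu : (index u s < k)%N by rewrite index_mem.
    have := congr1 (fun v : 'I_k -> E => v (Ordinal lu)) T0.
    by rewrite TE /= nth_index.
  rewrite TE; apply: funext => l; rewrite -cE ev0 //.
  by apply: mem_nth.
have [T' T'E] : exists T' : {linear quotmod S -> ('I_k -> E : lmodType A)},
    forall z, T' (qpi S z) = T z.
  apply: factor_surj => [|z]; first exact: qpi_surj.
  by move/(qpi0 z sS)/TS.
have iT' : injective T'.
  apply/lin_inj0 => y; have [z <-] := qpi_surj y.
  by rewrite T'E => /TS/(qpi0 z sS).
apply: (fgset_type iT').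
pose d (j : 'I_k) : 'I_k -> E := fun l => if l == j then e else 0.
apply: (@noetherian_sub _ _ [seq d j | j <- enum 'I_k] _ nA).
  exact: submodule_range.
move=> _ [y <-]; have [z <-] := qpi_surj y; rewrite T'E {T' T'E iT' y}.
have [b bE] : exists b : 'I_k -> A, forall l, T z l = b l *: e.
  have hb l : exists b, T z l = b *: e.
    apply: socE => a ma; rewrite TE.
    have [c cE] := mC a ma (kerv z) (kerv0 z).
    have := ev0 c _ (mem_nth 0 (ltn_ord l)).
    by rewrite cE !linearZ.
  by exists (fun l => projT1 (cid (hb l))) => l; case: cid.
have -> : T z = \sum_j b j *: d j.
  apply: funext => l; rewrite fct_sumE bE (bigD1 l) //= big1.
    by rewrite addr0 -[RHS]/(b l *: d l l) /d eqxx.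
  move=> j jl; rewrite -[LHS]/(b j *: d j l) /d.
  by rewrite eq_sym (negPf jl) scaler0.
apply: submodule_sum => [|j]; first exact: submodule_lspan.
by apply/lspan_mem/map_f; rewrite mem_enum.
Qed.

End KoszulHomology.

Section Approximation.
Variable A : comNzRingType.
Hypothesis nA : noetherian A.
Variable P : complex A.
Hypothesis prP : forall i, projective (P i).
Hypothesis fgH : forall i, finite_type (homology (cd P i) (pd P i)).
Implicit Types N Q : lmodType A.

(** The complex P may be replaced, below position n, by finitely generated free
    modules: the part above n then resolves a finitely generated module. The
    projective Q is obtained from P n by n successive pullbacks along maps from
    finitely generated free modules, chosen to be surjective modulo boundaries;
    pulling back does not change the cycles. *)
Lemma fg_approximation n : exists Q N (d : {linear P n -> Q}) (p : {linear Q -> N}),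
  [/\ projective Q, finite_type N, forall x, d x = 0 <-> pd P n x = 0,
      epi p & exact d p].
Proof.
elim: n => [|n [Q [N [d [p [prQ fN dE ep pe]]]]]].
  have [N [p [ep pe]]] := cokernel (pd P 0).
  exists (prev P 0), N, (pd P 0), p; split=> //; first exact: rV_projective.
  exact: fg_epi ep (fg_rV A 0).
have [k [f ef]] := fg_cover fN.
have [phi phiE] := @rV_projective A k _ _ p f ep.
pose F : lmodType A := 'rV[A]_k.
have lt : linear (fun z : P n * F => d z.1 + phi z.2).
  by move=> a x y; rewrite !linearP scalerDr addrACA.
pose tau := mklin lt; pose Q' := kerm tau.
have etau : epi tau.
  move=> y; have [v vE] := ef (p y).
  have /pe[x xE] : p (y - phi v) = 0 by rewrite linearB phiE vE subrr.
  by exists (x, v); rewrite /= xE subrK.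
have kt : ses (@kerv A _ _ tau) tau.
  by split; [exact: kerv_inj|by []|exact: kerv_exact].
have l1 : linear (fun x : P n.+1 => (cd P n x, 0) : P n * F).
  by move=> a x y; congr pair; rewrite /= ?linearP // scaler0 addr0.
have [|d' d'e] := ses_into kt (f := mklin l1).
  by move=> x /=; rewrite linear0 addr0; apply/dE/pd_cd.
have d'E x : kerv (d' x) = (cd P n x, 0) by exact: d'e.
have [N' [p' [ep' pe']]] := cokernel d'.
exists Q', N', d', p'; split=> //.
- apply: (kernel_projective kt) => //.
  by apply: prod_projective; [exact: prP|exact: rV_projective].
- have lr : linear (fun z : Q' => (kerv z).2 : F) by [].
  have [r rE] : exists r : {linear N' -> F}, forall z, r (p' z) = (kerv z).2.
    apply: (@factor_surj _ _ _ _ p' (mklin lr)) => // z /pe'[x <-] /=.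
    by rewrite d'E.
  pose Z := kerm (pd P n).
  have l2 : linear (fun z : Z => (kerv z, 0) : P n * F).
    by move=> a x y; congr pair; rewrite /= ?linearP // scaler0 addr0.
  have [|c ce] := ses_into kt (f := mklin l2).
    by move=> z /=; rewrite linear0 addr0; apply/dE/kerv0.
  have cE z : kerv (c z) = (kerv z, 0) by exact: ce.
  pose S := [set z : Z | exists u, cd P n u = kerv z].
  have sS : submodule S.
    split=> [|a x y [u uE] [v vE]]; first by exists 0; rewrite !linear0.
    by exists (a *: u + v); rewrite !linearP uE vE.
  have [h hE] : exists h : {linear quotmod S -> N'},
      forall z, h (qpi S z) = p' (c z).
    have [p'c p'cE] := comp_lin p' c.
    have [|z|h hE] := @factor_surj _ _ _ _ (qpi S) p'c.
    - exact: qpi_surj.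
    - move=> /(qpi0 z sS)[u uE]; rewrite p'cE; apply/pe'; exists u.
      by apply: kerv_inj; rewrite d'E cE uE.
    by exists h => z; rewrite hE p'cE.
  apply: (fg_exact (f := h) (g := r) nA) (fgH n) (fg_rV A k) => y.
  split=> [|[w <-]]; last first.
    by have [z <-] := qpi_surj w; rewrite hE rE cE.
  have [z <-] := ep' y; rewrite rE => z2.
  have tz : d (kerv z).1 = 0.
    by have := kerv0 z; rewrite /= z2 linear0 addr0.
  have [x xE] := to_kerm ((dE _).1 tz).
  exists (qpi S x); rewrite hE; congr (p' _); apply: kerv_inj.
  by rewrite cE xE -z2 -surjective_pairing.
- move=> x; split=> [dx|cx]; first by have /= := d'E x; rewrite dx => -[].
  by apply: kerv_inj; rewrite d'E linear0 [cd P n x]cx.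
Qed.

Lemma fg_resolved n : (forall i, (n <= i)%N -> cexact P i) ->
  exists N, finite_type N /\
    forall W i, ExtV i.+1 N W <-> hexact P W (i.+1 + n).
Proof.
move=> exP; have [Q [N [d [p [prQ fN dE ep pe]]]]] := fg_approximation n.
exists N; split=> // W i.
pose obj i : lmodType A := if i is j.+1 then P (j + n) else Q.
pose bd i : {linear obj i.+1 -> obj i} :=
  match i return {linear obj i.+1 -> obj i} with
  | 0 => d | j.+1 => cd P (j + n) end.
have bdd j x : bd j (bd j.+1 x) = 0.
  case: j x => [|j] x; last exact: cdd.
  exact/dE/pd_cd.
pose R := @Complex A obj bd bdd.
rewrite (@resolution_hexact A R N p W) //; first by case=> [|j]; [exact: prQ|exact: prP].
case=> [|j] a; first by move/dE/(exP n (leqnn n)).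
by apply: (exP (j.+1 + n)); rewrite leq_addl.
Qed.

End Approximation.

(** * Injective dimension and Ext of the residue field *)

Section Bass.
Variables (A : comNzRingType) (m : set A).
Hypothesis hA : noetherian_local m.
Implicit Types U V W Z : lmodType A.

(** The module of maps from the syzygy U of Z to A is finitely generated, hence
    so is its quotient Ext^1(Z, A). *)
Lemma xext_nakayama x Z : m x -> finite_type Z ->
  xExt x 0 Z A^o -> ExtV 0 Z A^o.
Proof.
move=> mx fZ; have [nA lA] := hA.
have [k [U [q [p [qp fU]]]]] := fg_ses nA fZ.
rewrite /ExtV /xExt !(xextP _ _ qp (@rV_projective A k)) => Hx f.
have [s sU] := (finite_typeP _).1 (dual_fg nA fU).
have sB := submodule_range (precomp A^o q).
have Bs : forall u, u \in s -> exists g, precomp A^o q g = u.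
  apply: (nakayama lA sB mx) => u _; have [f' [g fE]] := Hx (homv u).
  exists (precomp A^o q (to_hom g)), (to_hom f'); split=> //.
    by exists (to_hom g).
  by apply: homP => z; rewrite fE addrC.
have [g gE] := lspan_sub sB Bs (sU (to_hom f)).
exists f, (homv g) => u; rewrite scale0r add0r.
by have := congr1 (fun h => homv h u) gE => /= <-.
Qed.

(** Extending a map along multiplication by x means dividing it by x, and the
    obstruction lies in Ext of the cokernel, one degree higher. *)
Lemma Ext_mul_epi x i V W Z (mu : {linear V -> V}) (c : {linear V -> Z}) :
  ses mu c -> (forall v, mu v = x *: v) -> ExtV i.+1 Z W -> xExt x i V W.
Proof.
move=> mc muE; rewrite /ExtV /xExt /= => HZ f.
have [f' f'E] := Ext1_extend mc (HZ : ExtV 0 Z _) f.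
by exists f', \0 => v; rewrite linear0 addr0 -f'E muE lin_scale.
Qed.

(** The bound on the degree does not depend on the ideal: if x is a nonzero
    divisor on A/J, the vanishing of Ext^{i+1}(A/(J + xA), A) gives
    Ext^i(A/J, A) = x Ext^i(A/J, A). If x is a zero divisor there, A/J is an
    extension of A/(J + xA) by A/(J : x), for two larger ideals. *)
Lemma Ext_residue_cyclic s (k : lmodType A) (q : {linear A^o -> k}) :
  epi q -> (forall a, q a = 0 <-> m a) ->
  (forall i, (s <= i)%N -> ExtV i k A^o) ->
  forall J, ideal J -> forall V (p : {linear A^o -> V}), epi p ->
    (forall a, p a = 0 <-> J a) -> forall i, (s <= i)%N -> ExtV i V A^o.
Proof.
move=> eq qm Extk; have [nA lA] := hA; apply: (noetherian_ind nA).
move=> J iJ IH V p ep pJ i si.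
have [J1|J1] := pselect (J 1).
  apply/Ext_projective/zero_projective => v; have [a <-] := ep v.
  by apply/pJ; rewrite -[a]mulr1; apply: (submoduleZ a iJ J1).
have Jm := proper_sub_maximal lA iJ J1.
have [mJ|] := pselect (m `<=` J).
  have [e eE] : exists e : {linear k -> V}, forall a, e (q a) = p a.
    by apply: factor_surj => // a /qm/mJ/pJ.
  rewrite /ExtV -(@xExt_iso _ 0 i k V A^o e); first exact: Extk.
    apply/lin_inj0 => y; have [a <-] := eq y.
    by rewrite eE => /pJ/Jm/qm.
  by move=> v; have [a <-] := ep v; exists (q a).
move=> /existsNP[x /not_implyP[mx nJx]].
have im := ideal_maximal lA.
(* V3 is A/(J + xA), and V1 is A/(J : x), which embeds in V by x *)
have [mu muE] := scale_lin x (mklin (linearP (idfun : {linear V -> V}))).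
have {}muE v : mu v = x *: v by rewrite muE.
have [V3 [c [ec mc]]] := cokernel mu.
have [cp cpE] := comp_lin c p.
have ecp : epi cp by move=> y; have [v <-] := ec y; have [a <-] := ep v; exists a.
have Ext3 j : (s <= j)%N -> ExtV j V3 A^o.
  have iJ3 : ideal [set a | cp a = 0] by apply: submodule_ker.
  apply: (IH _ iJ3 _ _ V3 cp ecp) => // [a /pJ pa0|E]; first by
    rewrite /mkset cpE pa0 linear0.
  apply: nJx; rewrite -E /mkset cpE; apply/mc; exists (p 1).
  by rewrite muE -lin_scale [_ *: _]mulr1.
have [mup mupE] := comp_lin mu p.
have iJ1 : ideal [set a | mup a = 0] by apply: submodule_ker.
have [V1 [p1 [ep1 p1E]]] := @quotient_exists A A^o _ iJ1.
have [j jE] : exists j : {linear V1 -> V}, forall a, j (p1 a) = mup a.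
  by apply: factor_surj => // a /p1E.
have jc : ses j c.
  split=> //; first by apply/lin_inj0 => y; have [a <-] := ep1 y;
    rewrite jE => mup0; apply/p1E.
  move=> v; rewrite mc; split=> [[w <-]|[y <-]].
    by have [a <-] := ep w; exists (p1 a); rewrite jE mupE.
  by have [a <-] := ep1 y; exists (p a); rewrite jE mupE.
have J1J : J `<=` [set a | mup a = 0].
  by move=> a /pJ pa0; rewrite /mkset mupE pa0 linear0.
have [E|neJ] := pselect ([set a | mup a = 0] = J); last first.
  by apply: (Ext_middle jc); [apply: (IH _ iJ1 J1J neJ V1 p1)|apply: Ext3].
have mc' : ses mu c.
  split=> //; apply/lin_inj0 => v; have [a <-] := ep v => mu0.
  by apply/pJ; rewrite -E /mkset mupE.
have Hx : xExt x i V A^o := Ext_mul_epi mc' muE (Ext3 i.+1 (leqW si)).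
have fV : finite_type V.
  apply: (fg_epi ep); apply/finite_typeP; exists [:: 1] => a /=; exists a.
  by rewrite /mkset [_ *: _]mulr1 subrr.
have [Z [fZ ZE]] := fg_syzygy i nA fV.
by apply/ZE/(xext_nakayama mx fZ)/ZE.
Qed.

Lemma cores_cosyzygy (P : lmodType A -> Prop) W n k :
  (forall V, P (inj_env V)) ->
  has_cores P k (cosyzygy W n) -> has_cores P (n + k)%N W.
Proof.
move=> PJ; elim: n k => [|n IHn] k H //; rewrite addSnnS; apply: IHn.
by exists (cosyz (cosyzygy W n)), (inj_env (cosyzygy W n)),
  (env_in _), (env_out _); split=> //; exact: env_ses.
Qed.

(** By Baer's criterion, the vanishing of Ext^{s+1}(A/J, A) for all J is the
    injectivity of the s-th cosyzygy of A. *)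
Lemma Ext_residue_inj_dim s (k : lmodType A) (q : {linear A^o -> k}) :
  epi q -> (forall a, q a = 0 <-> m a) ->
  (forall i, (s <= i)%N -> ExtV i k A^o) -> finite_inj_dim A^o.
Proof.
move=> eq qm Extk; have ExtJ := Ext_residue_cyclic eq qm Extk.
have injW : injective_module (cosyzygy A^o s).
  apply: baer => J g iJ gP.
  have [U [i [ii iE]]] := @submodule_type A A^o J iJ.
  have [V [p [ep pE]]] := @quotient_exists A A^o J iJ.
  have ip : ses i p by split=> // a; rewrite pE iE.
  have Ji u : J (i u) by apply/iE; exists u.
  have lg : linear (fun u => g (i u)).
    by move=> a x y; rewrite linearP; apply: gP.
  have [h hE] := Ext1_extend ip
    (ExtJ J iJ V p ep pE s (leqnn s) : ExtV 0 V (cosyzygy A^o s)) (mklin lg).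
  exists (h 1) => u /iE[v <-]; rewrite -lin_scale -[RHS]/(h (i v * 1)).
  by rewrite mulr1 hE.
have [|F FE] := @has_cores_coresolution A (@injective_module A) (s + 0)%N A^o.
  apply: cores_cosyzygy; first exact: inj_env_injective.
  exists (cosyzygy A^o s), (mklin (linearP (idfun : {linear cosyzygy A^o s -> _}))).
  by split=> //; split=> [x y|y] //=; exists y.
by exists (s + 0)%N, F.
Qed.

End Bass.

Section TestModules.
Variables (A : comNzRingType) (m : set A) (M : lmodType A).
Hypotheses (hA : noetherian_local m) (hM : test_module m M).

Lemma restr_id_iso (N : lmodType A) :
  exists e : {linear N -> restr (idfun : {rmorphism A -> A}) N}, bijlin e.
Proof.
have le : linear ((fun x => x) : N -> restr (idfun : {rmorphism A -> A}) N) by [].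
by exists (mklin le); split=> [x y|y] //=; exists y.
Qed.

(** The test property for the identity of A, in terms of Ext. *)
Lemma test_module_Ext s (N : lmodType A) : finite_type N ->
  (forall i, (s <= i)%N -> ExtV i M (cdual N)) ->
  exists n, forall V i, (n <= i)%N -> ExtV i N (cdual V).
Proof.
move=> fN EMN; have [_ test] := hM.
have [e [ie ee]] := restr_id_iso N.
have isoN V i : ExtV i N (cdual V) <-> 
    ExtV i (restr (idfun : {rmorphism A -> A}) N) (cdual V).
  exact: xExt_iso ie ee.
have /flat_dim_Ext[n nE] : finite_flat_dim (restr (idfun : {rmorphism A -> A}) N).
  apply: (test A m idfun hA _ N fN); first by move=> a.
  exists s.+1 => -[//|i] si; apply: Tor_vanish.
  by apply/Ext_balance/isoN/Ext_balance/EMN.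
by exists n => V i ni; apply/isoN/nE.
Qed.

(** Exactness of Hom(P, W) in high degrees, for P the Koszul complex on a free
    resolution of E, is what ties N to E: with W the character dual of M it goes
    from E to N, and with W the character dual of k from N back to E. *)
Lemma test_Gdim_gorenstein : finite_Gdim M -> gorenstein A.
Proof.
move=> /Gdim_Ext[s0 EMA]; have [nA lA] := hA; have [fM _] := hM.
have [E [e [injE en0 me socE]]] := residue_hull lA.
have im := ideal_maximal lA.
have [k [q [eq qm]]] := @quotient_exists A A^o m im.
have [xs xsm mxs] : exists2 xs : seq A, forall x, x \in xs -> m x &
    m `<=` @lspan A A^o xs.
  have [|xs [xsm mxs]] := @noetherian_sub A A^o [:: 1] m nA im.
    by move=> a _ /=; exists a; rewrite /mkset [_ *: _]mulr1 subrr.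
  by exists xs.
pose P := koszul xs (free_complex E).
pose D := koszul xs (degree0 E).
have PD : racyclic P D by apply/racyclic_koszul/free_complex_degree0.
have prP i : projective (P i).
  by apply: koszul_projective => j; exact: free_projective.
have exP i : (size xs + 1 <= i)%N -> cexact P i.
  move=> ni; apply: (racyclic_exact PD).
  apply: (@koszul_bounded _ xs (degree0 E) 1 _ i ni) => -[//|j] _.
  exact: zero_lmod.
have fgP i : finite_type (homology (cd P i) (pd P i)).
  apply: (koszul_homology_fg nA injE socE PD).
    exact/hom_complex_koszul/hom_complex_degree0.
  move=> y /mxs ys a da.
  apply: (@lspan_sub A A^o xs [set y | exists c, cd P i c = (y : A) *: a] _ _ y ys).
    split=> [|b u v [c cE] [d dE]]; first by exists 0; rewrite linear0 scale0r.
    by exists (b *: c + d); rewrite linearP cE dE scalerDl scalerA.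
  move=> x /(null_homotopic_koszul (free_complex E))[h hE].
  exists (h i a); rewrite -hE da linear0 addr0.
  by [].
have [N [fN NE]] := fg_resolved nA prP fgP exP.
pose n := (size xs + 1)%N.
have EMN i : (s0 + n <= i)%N -> ExtV i M (cdual N).
  case: i => [|i] ni; first by move: ni; rewrite /n addn1 addnS.
  apply/Ext_balance/NE; apply: (@hexact_koszul _ _ _ _ s0.+1).
    case=> // j sj; apply/free_complex_hexact/Ext_balance.
    exact: (Ext_ring_dual nA fM injE (EMA j sj)).
  rewrite /n [(i.+1 + _)%N]addnC -addnA leq_add2l add1n ltnS.
  by apply: leq_trans ni; rewrite leq_addr.
have [n1 n1E] := test_module_Ext fN EMN.
have kx x : x \in xs -> forall w : cdual k, x *: w = 0.
  move=> /xsm mx w; apply: homP => v; have [a <-] := eq v.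
  rewrite -[LHS]/(x *: homv w (q a)) -!lin_scale.
  by rewrite (_ : q _ = 0) ?linear0 //; apply/qm; rewrite [_ *: _]mulrC;
     apply: (submoduleZ a im mx).
have Ek i : (n1.+1 + n <= i)%N -> ExtV i k A^o.
  move=> ni; apply: (Ext_dual_ring hA _ injE en0 me).
    apply: (fg_epi eq); apply/finite_typeP; exists [:: 1] => a /=; exists a.
    by rewrite /mkset [_ *: _]mulr1 subrr.
  apply/Ext_balance/free_complex_hexact.
  apply: (@hexact_koszul_inv _ xs _ _ (n1.+1 + n)%N) => // [j nj|]; last exact: leqW.
  rewrite -(subnKC nj) addnAC addSn.
  by apply/NE; apply: n1E; apply/leqW/leq_addr.
split=> //; first by exists m.
exact: (Ext_residue_inj_dim hA eq qm Ek).
Qed.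

End TestModules.

Theorem theorem9 (A : comNzRingType) (m : set A) (M : lmodType A)
  (hA : noetherian_local m) (hM : test_module m M) :
  gorenstein A <-> finite_Gdim M.
Proof.
split; last exact: test_Gdim_gorenstein hA hM.
by case: hM => fM _ gA; exact: gorenstein_finite_Gdim.
Qed.
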